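(* Let $H$ be a Hopf algebra with invertible antipode $S$ over a field $k$ of characteristic $0$ and let $i\in\mathbb{Z}$. Let $\mathbb{Z}$ act on $YD_{i-1}\text{-mod}$ and on $YD_{i+1}\text{-ctrmd}$ with $1\in\mathbb{Z}$ acting by $M\mapsto{}_{S^{-2}}M^{S^2}$. (1) For $M\in YD_{i-1}\text{-mod}$ the map $\sigma_M:M\to{}_{S^{2i}}M^{S^{-2i}}$, $m\mapsto S^{2i}(m_1)m_0$, is an isomorphism in $YD_{i-1}\text{-mod}$ with inverse $m\mapsto S^{-1}(m_1)m_0$, and $\sigma$ is a natural isomorphism from the identity functor of $YD_{i-1}\text{-mod}$ to the action of $-i\in\mathbb{Z}$. (2) For $N\in YD_{i+1}\text{-ctrmd}$ the map $\sigma_N:N\to{}_{S^{2i}}N^{S^{-2i}}$, $n\mapsto\alpha(r_n)$ where $r_n(h)=hn$, is an isomorphism in $YD_{i+1}\text{-ctrmd}$ with inverse $n\mapsto\alpha(h\mapsto S^{2i-1}(h)n)$, and $\sigma$ is a natural isomorphism from the identity functor of $YD_{i+1}\text{-ctrmd}$ to the action of $-i\in\mathbb{Z}$. Thus the actions of $\mathbb{Z}$ on $YD_{i-1}\text{-mod}$ and on $YD_{i+1}\text{-ctrmd}$ factor (up to these canonical isomorphisms) through $\mathbb{Z}/i\mathbb{Z}$; in particular (case $i=1$) every Yetter-Drinfeld module $M$ (i.e. $YD_0$-module) is canonically isomorphic to ${}_{S^{-2}}M^{S^2}$ as a Yetter-Drinfeld module.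
   Context: Sweedler notation: $\Delta(h)=h^1\otimes h^2$; a right coaction is $m\mapsto m_0\otimes m_1$; $f(a-b)$ means $x\mapsto f(axb)$; $\mathrm{Hom}$ denotes $k$-linear maps. A right $H$-contramodule is a vector space $N$ with linear $\alpha:\mathrm{Hom}(H,N)\to N$ such that $\alpha(x\mapsto\alpha(h\mapsto f(x\otimes h)))=\alpha(h\mapsto f(h^1\otimes h^2))$ for $f\in\mathrm{Hom}(H\otimes H,N)$ and $\alpha(h\mapsto\epsilon(h)n)=n$. For $j\in\mathbb{Z}$, a $YD_j$-module is a left $H$-module and right $H$-comodule $M$ with $(hm)_0\otimes(hm)_1=h^2m_0\otimes h^3m_1S^{-1-2j}(h^1)$. A $YD_j$-contramodule is a left $H$-module and right $H$-contramodule $N$ with $h\alpha(f)=\alpha(h^2f(S(h^3)-S^{2-2j}(h^1)))$. Morphisms preserve both structures. For $j\in\mathbb{Z}$, ${}_{S^{-2j}}M^{S^{2j}}$ is the same vector space with $H$-action modified to $h\cdot m=S^{-2j}(h)m$ and with coaction modified to $m_0\otimes S^{2j}(m_1)$ (module case), respectively contraaction modified to $f\mapsto\alpha(f\circ S^{2j})$ (contramodule case). All formulas for $\sigma$ and its inverse use the original structures of $M$ and $N$. *)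

(* Defs.v *)
From HB Require Import structures.
From mathcomp Require Import all_boot all_order all_algebra.
From mathcomp Require Import boolp.
Set Implicit Arguments.
Unset Strict Implicit.
Unset Printing Implicit Defensive.
Import GRing.Theory.
Local Open Scope ring_scope.
Local Open Scope quotient_scope.

Section Tensor.
Variables (k : fieldType) (V W : lmodType k).
Implicit Types s t u : seq (V * W).

(* A list of pairs [:: (v1, w1); ...; (vn, wn)] stands for the sum of the
   simple tensors vi (x) wi. *)
Inductive tens_rel : seq (V * W) -> seq (V * W) -> Prop :=
| tens_refl s : tens_rel s s
| tens_sym s t : tens_rel s t -> tens_rel t s
| tens_trans s t u : tens_rel s t -> tens_rel t u -> tens_rel s u
| tens_cat s s' t t' :
    tens_rel s s' -> tens_rel t t' -> tens_rel (s ++ t) (s' ++ t')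
| tens_perm s t : tens_rel (s ++ t) (t ++ s)
| tens_addl v v' w : tens_rel [:: (v + v', w)] [:: (v, w); (v', w)]
| tens_addr v w w' : tens_rel [:: (v, w + w')] [:: (v, w); (v, w')]
| tens_scale (a : k) v w : tens_rel [:: (a *: v, w)] [:: (v, a *: w)]
| tens_zero w : tens_rel [:: (0, w)] [::].

Definition tens_relb (s t : seq (V * W)) : bool := `[< tens_rel s t >].

Lemma tens_relb_refl : reflexive tens_relb.
Proof. by move=> s; apply/asboolP; apply: tens_refl. Qed.
Lemma tens_relb_sym : symmetric tens_relb.
Proof. by move=> s t; apply/asboolP/asboolP; apply: tens_sym. Qed.
Lemma tens_relb_trans : transitive tens_relb.
Proof. by move=> t s u /asboolP st /asboolP tu; apply/asboolP; apply: tens_trans st tu. Qed.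

Canonical tens_equiv :=
  EquivRel tens_relb tens_relb_refl tens_relb_sym tens_relb_trans.

Definition tens := {eq_quot tens_equiv}.
HB.instance Definition _ := Choice.on tens.
HB.instance Definition _ := EqQuotient.on tens.

Lemma tens_piP s t : reflect (\pi_tens s = \pi_tens t) `[< tens_rel s t >].
Proof. exact: (eqmodP tens_equiv). Qed.

Lemma tens_pi s t : tens_rel s t -> \pi_tens s = \pi_tens t.
Proof. by move=> st; apply/tens_piP/asboolP. Qed.

Lemma tens_reprP s : tens_rel (repr (\pi_tens s)) s.
Proof. by apply/asboolP/tens_piP; rewrite reprK. Qed.

Definition tens_add (x y : tens) : tens := \pi_tens (repr x ++ repr y).
Definition tens_scalef (a : k) (x : tens) : tens :=
  \pi_tens [seq (a *: p.1, p.2) | p <- repr x].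

Lemma tens_addE s t : tens_add (\pi_tens s) (\pi_tens t) = \pi_tens (s ++ t).
Proof. by apply: tens_pi; apply: tens_cat; apply: tens_reprP. Qed.

Lemma tens_scale_rel a s t : tens_rel s t ->
  tens_rel [seq (a *: p.1, p.2) | p <- s] [seq (a *: p.1, p.2) | p <- t].
Proof.
elim=> {s t} /=.
- by move=> s; apply: tens_refl.
- by move=> s t _; apply: tens_sym.
- by move=> s t u _ st _; apply: tens_trans.
- by move=> s s' t t' _ ss' _ tt'; rewrite !map_cat; apply: tens_cat.
- by move=> s t; rewrite !map_cat; apply: tens_perm.
- by move=> v v' w; rewrite scalerDr; apply: tens_addl.
- by move=> v w w'; apply: tens_addr.
- by move=> b v w; rewrite scalerA mulrC -scalerA; apply: tens_scale.
- by move=> w; rewrite scaler0; apply: tens_zero.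
Qed.

Lemma tens_scaleE a s :
  tens_scalef a (\pi_tens s) = \pi_tens [seq (a *: p.1, p.2) | p <- s].
Proof. by apply: tens_pi; apply: tens_scale_rel; apply: tens_reprP. Qed.

Definition tens_opp := tens_scalef (-1).

Lemma tens_addA : associative tens_add.
Proof.
move=> x y z; rewrite -[x]reprK -[y]reprK -[z]reprK.
move: (repr x) (repr y) (repr z) => s t u.
by rewrite (tens_addE t u) (tens_addE s t) (tens_addE s) (tens_addE _ u) catA.
Qed.
Lemma tens_addC : commutative tens_add.
Proof.
move=> x y; rewrite -[x]reprK -[y]reprK.
rewrite (tens_addE (repr x) (repr y)) (tens_addE (repr y) (repr x)).
exact/tens_pi/tens_perm.
Qed.
Lemma tens_add0 : left_id (\pi_tens [::]) tens_add.
Proof. by move=> x; rewrite -[x]reprK tens_addE. Qed.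

Lemma tens_split a b s : tens_rel [seq ((a + b) *: p.1, p.2) | p <- s]
  ([seq (a *: p.1, p.2) | p <- s] ++ [seq (b *: p.1, p.2) | p <- s]).
Proof.
elim: s => [|[v w] s IHs] /=; first exact: tens_refl.
apply: tens_trans (_ : tens_rel ([:: (a *: v, w); (b *: v, w)] ++ _) _).
  rewrite -[X in tens_rel X _]cat1s; apply: tens_cat IHs.
  by rewrite scalerDl; apply: tens_addl.
rewrite /= -[X in tens_rel X _]cat1s -[X in tens_rel _ X]cat1s.
apply: tens_cat; first exact: tens_refl.
rewrite -[X in tens_rel X _]cat1s -[_ :: map _ s]cat1s !catA.
by apply: tens_cat; [apply: tens_perm | apply: tens_refl].
Qed.

Lemma tens_scale0 s : tens_rel [seq (0 *: p.1, p.2) | p <- s] [::].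
Proof.
elim: s => [|[v w] s IHs] /=; first exact: tens_refl.
rewrite -[X in tens_rel X _]cat1s -[X in tens_rel _ X]cat0s.
by apply: tens_cat IHs; rewrite scale0r; apply: tens_zero.
Qed.

Lemma tens_addN : left_inverse (\pi_tens [::]) tens_opp tens_add.
Proof.
move=> x; rewrite -[x]reprK /tens_opp tens_scaleE tens_addE; apply: tens_pi.
set s := repr x.
have -> : s = [seq (1 *: p.1, p.2) | p <- s].
  by rewrite -[LHS]map_id; apply: eq_map => -[v w] /=; rewrite scale1r.
rewrite -map_comp /comp /=; under eq_map do rewrite scale1r.
apply: tens_trans (tens_scale0 s).
by apply: tens_sym; rewrite -[0](addNr 1); apply: tens_split.
Qed.

HB.instance Definition _ :=
  GRing.isZmodule.Build tens tens_addA tens_addC tens_add0 tens_addN.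

Lemma tens_scalerA a b x :
  tens_scalef a (tens_scalef b x) = tens_scalef (a * b) x.
Proof.
rewrite -[x]reprK; move: (repr x) => s.
rewrite (tens_scaleE b s) (tens_scaleE _ s) (tens_scaleE a) -map_comp.
by congr (\pi_tens _); apply: eq_map => p /=; rewrite scalerA.
Qed.
Lemma tens_scale1r : left_id 1 tens_scalef.
Proof.
move=> x; rewrite -[x]reprK tens_scaleE; congr (\pi_tens _).
by rewrite -[RHS]map_id; apply: eq_map => -[v w] /=; rewrite scale1r.
Qed.
Lemma tens_scalerDr : right_distributive tens_scalef +%R.
Proof.
move=> a x y; rewrite -[x]reprK -[y]reprK [_ + _]tens_addE !tens_scaleE.
by rewrite [RHS]tens_addE map_cat.
Qed.
Lemma tens_scalerDl x : {morph tens_scalef^~ x : a b / a + b}.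
Proof.
move=> a b /=; rewrite -[x]reprK !tens_scaleE [RHS]tens_addE.
exact/tens_pi/tens_split.
Qed.

HB.instance Definition _ := GRing.Zmodule_isLmodule.Build k tens
  tens_scalerA tens_scale1r tens_scalerDr tens_scalerDl.

Definition tpure (v : V) (w : W) : tens := \pi_tens [:: (v, w)].

(* The sum of F v w over the pairs (v, w) of a chosen list representing x; it
   is independent of the choice when F is bilin. *)
Definition tsum (U : zmodType) (x : tens) (F : V -> W -> U) : U :=
  \sum_(p <- repr x) F p.1 p.2.

End Tensor.
Arguments tens {k} V W.

Notation "V ⊗ W" := (tens V W) (at level 40, left associativity) : type_scope.
Notation "v ⊗ w" := (tpure v w) (at level 40, left associativity) : ring_scope.
Notation "\sw_ ( v ⊗ w <- x ) E" := (tsum x (fun v w => E))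
  (at level 41, v name, w name, x at level 41, E at level 41,
   format "'[' \sw_ ( v  ⊗  w  <-  x ) '/  '  E ']'") : ring_scope.

Definition bilin (k : fieldType) (V W U : lmodType k) (F : V -> W -> U) :=
  (forall w, linear (F^~ w)) /\ (forall v, linear (F v)).
Section TensorTheory.
Variable (k : fieldType).
Implicit Types V W U : lmodType k.

Lemma linD V U (f : V -> U) : linear f -> forall x y, f (x + y) = f x + f y.
Proof. by move=> lf x y; have := lf 1 x y; rewrite !scale1r. Qed.
Lemma lin0 V U (f : V -> U) : linear f -> f 0 = 0.
Proof. by move=> lf; apply: (addrI (f 0)); rewrite addr0 -linD // addr0. Qed.
Lemma linZ V U (f : V -> U) : linear f -> forall a x, f (a *: x) = a *: f x.
Proof. by move=> lf a x; rewrite -[_ *: x]addr0 lf lin0 // addr0. Qed.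
Lemma lin_sum V U (f : V -> U) : linear f ->
  forall I (r : seq I) E, f (\sum_(i <- r) E i) = \sum_(i <- r) f (E i).
Proof.
move=> lf I r E; elim: r => [|i r IH]; rewrite ?big_nil ?lin0 //.
by rewrite !big_cons linD // IH.
Qed.

Lemma tsum_rel V W U (F : V -> W -> U) s t : bilin F -> tens_rel s t ->
  \sum_(p <- s) F p.1 p.2 = \sum_(p <- t) F p.1 p.2.
Proof.
move=> [Fl Fr]; elim=> {s t} //=.
- by move=> s t u _ -> _ ->.
- by move=> s s' t t' _ IH _ IH'; rewrite !big_cat /= IH IH'.
- by move=> s t; rewrite !big_cat /= addrC.
- by move=> v v' w; rewrite !big_cons !big_nil /= (linD (Fl w)) addrA.
- by move=> v w w'; rewrite !big_cons !big_nil /= (linD (Fr v)) addrA.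
- by move=> a v w; rewrite !big_cons !big_nil /= (linZ (Fl w)) (linZ (Fr v)).
- by move=> w; rewrite !big_cons !big_nil /= (lin0 (Fl w)) addr0.
Qed.

Lemma tsum_pi V W U (F : V -> W -> U) s : bilin F ->
  tsum (\pi_(V ⊗ W) s) F = \sum_(p <- s) F p.1 p.2.
Proof. by move=> bF; apply: tsum_rel (tens_reprP s). Qed.

Lemma tsum_linear V W U (F : V -> W -> U) :
  bilin F -> linear (fun x => tsum x F).
Proof.
move=> bF a x y; rewrite -[x]reprK -[y]reprK.
rewrite [a *: _]tens_scaleE [_ + _]tens_addE !tsum_pi // big_cat big_map /=.
congr (_ + _); rewrite scaler_sumr; apply: eq_bigr => p _.
by rewrite (linZ (bF.1 p.2)).
Qed.

Lemma tsum_pure V W U (F : V -> W -> U) v w : bilin F ->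
  tsum (v ⊗ w) F = F v w.
Proof. by move=> bF; rewrite tsum_pi // big_cons big_nil addr0. Qed.

Lemma tpure_bilin V W : bilin (@tpure k V W).
Proof.
split=> [w a v v'|v a w w']; rewrite /tpure [a *: (\pi_(V ⊗ W) _)]tens_scaleE
  [RHS]tens_addE; apply: tens_pi => /=.
- exact: tens_addl.
- apply: tens_trans (tens_addr _ _ _) _.
  rewrite -[X in tens_rel X _]cat1s -[X in tens_rel _ X]cat1s.
  by apply: tens_cat (tens_refl _); apply: tens_sym; apply: tens_scale.
Qed.

Lemma tens_pureE V W (x : V ⊗ W) : x = \sw_(v ⊗ w <- x) (v ⊗ w).
Proof.
rewrite /tsum -[LHS]reprK; elim: (repr x) => [|[v w] s IH].
  by rewrite big_nil.
rewrite big_cons -IH /=.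
by rewrite [RHS]tens_addE.
Qed.

Lemma tens_ext V W U (f g : V ⊗ W -> U) : linear f -> linear g ->
  (forall v w, f (v ⊗ w) = g (v ⊗ w)) -> f =1 g.
Proof.
move=> lf lg fg x; rewrite (tens_pureE x) /tsum !lin_sum //.
by apply: eq_bigr.
Qed.
End TensorTheory.

Section LinearLemmas.
Variable (k : fieldType).
Implicit Types (V W U X : lmodType k) (A : algType k).

Lemma eq_tsum V W U (F G : V -> W -> U) x :
  (forall v w, F v w = G v w) -> tsum x F = tsum x G.
Proof. by move=> FG; apply: eq_bigr => p _; apply: FG. Qed.

Lemma tsumC V W V' W' U (F : V -> W -> V' -> W' -> U) x y :
  \sw_(v ⊗ w <- x) \sw_(v' ⊗ w' <- y) F v w v' w' =
  \sw_(v' ⊗ w' <- y) \sw_(v ⊗ w <- x) F v w v' w'.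
Proof. exact: exchange_big. Qed.

Lemma lin_tsum V W U X (L : U -> X) (F : V -> W -> U) x : linear L ->
  L (tsum x F) = \sw_(v ⊗ w <- x) L (F v w).
Proof. by move=> lL; rewrite /tsum lin_sum. Qed.

Lemma lin_id V : linear (fun x : V => x). Proof. by []. Qed.
Lemma lin_comp V W U (g : {linear W -> U}) (f : V -> W) :
  linear f -> linear (fun x => g (f x)).
Proof. by move=> lf a x y; rewrite lf linearP. Qed.
Lemma lin_mull V A (f : V -> A) c : linear f -> linear (fun x => f x * c).
Proof. by move=> lf a x y; rewrite lf mulrDl scalerAl. Qed.
Lemma lin_mulr V A (f : V -> A) c : linear f -> linear (fun x => c * f x).
Proof. by move=> lf a x y; rewrite lf mulrDr scalerAr. Qed.
Lemma lin_scale V W (f : V -> W) (c : k) : linear f -> linear (fun x => c *: f x).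
Proof. by move=> lf a x y; rewrite lf scalerDr !scalerA mulrC. Qed.
Lemma lin_scalar V W U (e : {scalar W}) (f : V -> W) (c : U) :
  linear f -> linear (fun x => e (f x) *: c).
Proof. by move=> lf a x y; rewrite lf linearP scalerDl scalerA. Qed.
Lemma lin_purel V W X (f : X -> V) (w : W) :
  linear f -> linear (fun x => f x ⊗ w).
Proof. by move=> lf a x y; rewrite lf (tpure_bilin V W).1. Qed.
Lemma lin_purer V W X (f : X -> W) (v : V) :
  linear f -> linear (fun x => v ⊗ f x).
Proof. by move=> lf a x y; rewrite lf (tpure_bilin V W).2. Qed.
Lemma lin_tsumr V W U X t (F : X -> V -> W -> U) :
  (forall v w, linear (fun x => F x v w)) ->
  linear (fun x => tsum t (F x)).
Proof.
move=> lF a x y; rewrite /tsum scaler_sumr -big_split /=.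
by apply: eq_bigr => p _; rewrite lF.
Qed.
Lemma lin_tsuml V W U X (T : X -> V ⊗ W) (F : V -> W -> U) :
  linear T -> bilin F -> linear (fun x => tsum (T x) F).
Proof. by move=> lT bF a x y; rewrite lT tsum_linear. Qed.

Definition mklin V W (f : V -> W) (lf : linear f) : {linear V -> W} :=
  HB.pack_for {linear V -> W} f (GRing.isLinear.Build k V W *:%R f lf).

Lemma linear_ext V W (f g : {linear V -> W}) : f =1 g -> f = g.
Proof.
case: f g => f [fA fZ] [g [gA gZ]] /= /funext fg; subst g.
have -> : fA = gA.
  case: fA gA => [[f0 fD]] [[g0 gD]].
  by rewrite (Prop_irrelevance g0 f0) (Prop_irrelevance gD fD).
have -> // : fZ = gZ.
by case: fZ gZ => fZ [gZ]; rewrite (Prop_irrelevance gZ fZ).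
Qed.
End LinearLemmas.
Arguments mklin {k V W} f lf.

Ltac lins_hook := fail.
Ltac lins :=
  cbv beta;
  lazymatch goal with
  | |- bilin _ => split; intro; lins
  | |- forall _, _ => intro; lins
  | |- _ /\ _ => split; lins
  | |- _ =>
    first [ assumption | apply: lin_id
          | apply: lin_mull; lins | apply: lin_mulr; lins
          | apply: lin_scalar; lins | apply: lin_scale; lins
          | apply: lin_purel; lins | apply: lin_purer; lins
          | apply: lin_tsumr; lins | apply: lin_tsuml; lins
          | lins_hook | apply: lin_comp; lins ]
  end.

(* The antipode is required to be invertible; its inverse antipode_inv is
   determined by antipodeK and antipode_invK. *)
Record hopfAlgebra (k : fieldType) := HopfAlgebra {
  hopf_alg :> algType k;
  comul : {linear hopf_alg -> tens hopf_alg hopf_alg};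
  counit : {scalar hopf_alg};
  antipode : {linear hopf_alg -> hopf_alg};
  antipode_inv : hopf_alg -> hopf_alg;
  comulA : forall h,
    \sw_(a ⊗ b <- comul h) \sw_(a1 ⊗ a2 <- comul a) (a1 ⊗ (a2 ⊗ b)) =
    \sw_(a ⊗ b <- comul h) (a ⊗ comul b);
  counitl : forall h, \sw_(a ⊗ b <- comul h) (counit a *: b) = h;
  counitr : forall h, \sw_(a ⊗ b <- comul h) (counit b *: a) = h;
  comul1 : comul 1 = 1 ⊗ 1;
  comulM : forall g h, comul (g * h) =
    \sw_(a ⊗ b <- comul g) \sw_(c ⊗ d <- comul h) ((a * c) ⊗ (b * d));
  counit1 : counit 1 = 1;
  counitM : forall g h, counit (g * h) = counit g * counit h;
  antipodel : forall h, \sw_(a ⊗ b <- comul h) (antipode a * b) = (counit h)%:A;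
  antipoder : forall h, \sw_(a ⊗ b <- comul h) (a * antipode b) = (counit h)%:A;
  antipodeK : cancel antipode antipode_inv;
  antipode_invK : cancel antipode_inv antipode
}.

Section HopfTheory.
Variables (k : fieldType) (H : hopfAlgebra k).
Implicit Types (U : lmodType k) (g h : H).
Notation Δ := (comul H).
Notation ε := (counit H).
Notation S := (antipode H).
Notation S' := (@antipode_inv k H).

Lemma sw_comulA U (F : H -> H -> H -> U) h :
  [/\ forall b c, linear (fun a => F a b c),
      forall a c, linear (fun b => F a b c) &
      forall a b, linear (fun c => F a b c)] ->
  \sw_(a ⊗ b <- Δ h) \sw_(c ⊗ d <- Δ a) F c d b =
  \sw_(a ⊗ b <- Δ h) \sw_(c ⊗ d <- Δ b) F a c d.
Proof.
move=> [F1 F2 F3].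
have b23 a : bilin (F a) by split=> ?; [apply: F2 | apply: F3].
pose G a y := \sw_(c ⊗ d <- y) F a c d.
have bG : bilin G.
  split=> [y|a]; first by apply: lin_tsumr => c d; apply: F1.
  exact: tsum_linear.
have lG := tsum_linear bG.
have /(congr1 (fun x => tsum x G)) := comulA h.
rewrite !(lin_tsum _ _ lG) => E.
transitivity (\sw_(a ⊗ b <- Δ h) tsum (\sw_(a1 ⊗ a2 <- Δ a) (a1 ⊗ (a2 ⊗ b))) G).
  apply: eq_tsum => a b; rewrite (lin_tsum _ _ lG).
  by apply: eq_tsum => c d; rewrite tsum_pure // /G tsum_pure.
by rewrite E; apply: eq_tsum => a b; rewrite tsum_pure.
Qed.

Lemma sw_counitl U (F : H -> U) h : linear F ->
  \sw_(a ⊗ b <- Δ h) (ε a *: F b) = F h.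
Proof.
move=> lF; rewrite -[in RHS](counitl h) (lin_tsum _ _ lF).
by apply: eq_tsum => a b; rewrite linZ.
Qed.

Lemma sw_counitr U (F : H -> U) h : linear F ->
  \sw_(a ⊗ b <- Δ h) (ε b *: F a) = F h.
Proof.
move=> lF; rewrite -[in RHS](counitr h) (lin_tsum _ _ lF).
by apply: eq_tsum => a b; rewrite linZ.
Qed.

Lemma antipode1 : S 1 = 1.
Proof.
have := antipodel (1 : H); rewrite comul1 tsum_pure; last by lins.
by rewrite mulr1 counit1 scale1r.
Qed.

Lemma antipodeM g h : S (g * h) = S h * S g.
Proof.
pose E1 := \sw_(a ⊗ b <- Δ g) \sw_(c ⊗ d <- Δ b) \sw_(e ⊗ f <- Δ h)
  \sw_(p ⊗ q <- Δ f) (S (a * e) * c * p * S q * S d).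
have {1}-> : S (g * h) = E1.
  symmetry; rewrite /E1.
  rewrite -[RHS](sw_counitr (F := fun g => S (g * h))); last by lins.
  apply: eq_tsum => a b.
  transitivity (\sw_(c ⊗ d <- Δ b) (S (a * h) * (c * S d))); last first.
    rewrite -(lin_tsum (L := fun x => S (a * h) * x)); last by lins.
    by rewrite antipoder -scalerAr mulr1.
  apply: eq_tsum => c d; rewrite !mulrA.
  rewrite -[RHS](sw_counitr (F := fun h => S (a * h) * c * S d)); last by lins.
  apply: eq_tsum => e f.
  transitivity (S (a * e) * c * (\sw_(p ⊗ q <- Δ f) (p * S q)) * S d).
    rewrite (lin_tsum (L := fun x => S (a * e) * c * x * S d)); last by lins.
    by apply: eq_tsum => p q; rewrite !mulrA.
  by rewrite antipoder -scalerAr mulr1 -scalerAl.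
pose E2 := \sw_(a ⊗ b <- Δ g) \sw_(c ⊗ d <- Δ a) \sw_(e ⊗ f <- Δ h)
  \sw_(p ⊗ q <- Δ e) (S (c * p) * d * q * S f * S b).
have -> : E1 = E2.
  rewrite /E1 /E2 -[LHS]sw_comulA; last by split; lins.
  apply: eq_tsum => a b; apply: eq_tsum => c d.
  by rewrite -[LHS]sw_comulA; last by split; lins.
rewrite -[RHS](sw_counitl (F := fun g => S h * S g)); last by lins.
apply: eq_tsum => a b; rewrite tsumC.
rewrite scalerAl -(sw_counitl (F := fun h => ε a *: S h)); last by lins.
rewrite [RHS](lin_tsum (L := fun x => x * S b)); last by lins.
apply: eq_tsum => e f.
transitivity ((\sw_(x ⊗ y <- Δ (a * e)) (S x * y)) * S f * S b); last first.
  by rewrite antipodel counitM -!scalerAl mul1r scalerA mulrC.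
rewrite comulM (lin_tsum (L := fun z => tsum z (fun x y => S x * y) * S f * S b)); last by lins.
apply: eq_tsum => c d.
rewrite (lin_tsum (L := fun z => tsum z (fun x y => S x * y) * S f * S b)); last by lins.
apply: eq_tsum => p q; rewrite tsum_pure; last by lins.
by rewrite !mulrA.
Qed.

Lemma counit_antipode h : ε (S h) = ε h.
Proof.
have epsA c : ε (c%:A : H) = c by rewrite linearZ /= counit1 mulr1.
rewrite -[LHS]epsA -[RHS]epsA; congr (ε _).
have /(congr1 (fun x => ε x *: (1 : H))) := antipodel h.
rewrite epsA => <-.
rewrite (lin_tsum (L := fun x => ε x *: (1 : H))); last by lins.
rewrite -[LHS](sw_counitr (F := fun x => ε (S x) *: (1 : H))); last by lins.
by apply: eq_tsum => a b; rewrite counitM mulrC scalerA.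
Qed.

Lemma comul_antipode h : Δ (S h) = \sw_(a ⊗ b <- Δ h) (S b ⊗ S a).
Proof.
pose E c d b := \sw_(u ⊗ v <- Δ (S c)) \sw_(p ⊗ q <- Δ d) \sw_(r ⊗ s <- Δ b)
  ((u * p * S s) ⊗ (v * q * S r)).
transitivity (\sw_(a ⊗ b <- Δ h) \sw_(c ⊗ d <- Δ b) E a c d).
  rewrite -[LHS](sw_counitr (F := fun h => Δ (S h))); last by lins.
  apply: eq_tsum => a b.
  transitivity (\sw_(u ⊗ v <- Δ (S a)) (ε b *: (u ⊗ v))).
    rewrite [in LHS](tens_pureE (Δ (S a))).
    by rewrite (lin_tsum (L := fun x => ε b *: x)) //; lins.
  rewrite /E tsumC; apply: eq_tsum => u v.
  rewrite [RHS](sw_comulA (F := fun p q d => \sw_(r ⊗ s <- Δ d)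
    ((u * p * S s) ⊗ (v * q * S r)))); last by split; lins.
  transitivity (\sw_(p ⊗ x <- Δ b) ((u * (p * S x)) ⊗ v)).
    rewrite -(lin_tsum (L := fun x => (u * x) ⊗ v)); last by lins.
    rewrite antipoder -scalerAr mulr1.
    by rewrite (linZ (f := fun x => x ⊗ v)); last by lins.
  apply: eq_tsum => p x.
  rewrite -[RHS](sw_comulA (F := fun q r s =>
    (u * p * S s) ⊗ (v * q * S r))); last by split; lins.
  rewrite mulrA -[LHS](sw_counitl (F := fun x => (u * p * S x) ⊗ v)); last by lins.
  apply: eq_tsum => y s.
  transitivity ((u * p * S s) ⊗ (v * \sw_(q ⊗ r <- Δ y) (q * S r))).
    rewrite antipoder -scalerAr mulr1.
    by rewrite (linZ (f := fun x => (u * p * S s) ⊗ x)); last by lins.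
  rewrite (lin_tsum (L := fun x => (u * p * S s) ⊗ (v * x))); last by lins.
  by apply: eq_tsum => q r; rewrite mulrA.
rewrite -[LHS]sw_comulA; last by split; rewrite /E; lins.
rewrite -[RHS](sw_counitl (F := fun b => \sw_(r ⊗ s <- Δ b) (S s ⊗ S r)));
  last by lins.
apply: eq_tsum => a b.
rewrite (lin_tsum (L := fun x => ε a *: x)); last by lins.
rewrite /E.
transitivity (\sw_(c ⊗ d <- Δ a) \sw_(r ⊗ s <- Δ b) \sw_(u ⊗ v <- Δ (S c))
   \sw_(p ⊗ q <- Δ d) ((u * p * S s) ⊗ (v * q * S r))).
  apply: eq_tsum => c d; rewrite [RHS]tsumC; apply: eq_tsum => u v.
  exact: tsumC.
rewrite tsumC; apply: eq_tsum => r s.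
pose M x := \sw_(y ⊗ z <- x) ((y * S s) ⊗ (z * S r)).
have lM : linear M by rewrite /M; lins.
transitivity (M (Δ (\sw_(c ⊗ d <- Δ a) (S c * d)))).
  rewrite (lin_tsum (L := fun x => M (Δ x))); last by rewrite /M; lins.
  apply: eq_tsum => c d; rewrite comulM (lin_tsum (L := M)) //.
  apply: eq_tsum => u v; rewrite (lin_tsum (L := M)) //.
  by apply: eq_tsum => p q; rewrite /M tsum_pure //; lins.
rewrite antipodel linearZ /= (linZ lM) comul1 /M tsum_pure; last by lins.
by rewrite !mul1r.
Qed.

Lemma antipode_inv_linear : linear S'.
Proof.
by move=> a x y; apply: (can_inj (@antipodeK k H)); rewrite linearP !antipode_invK.
Qed.
HB.instance Definition _ := GRing.isLinear.Build k H H *:%R S' antipode_inv_linear.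

Lemma antipode_inv1 : S' 1 = 1.
Proof. by rewrite -[X in S' X]antipode1 antipodeK. Qed.
Lemma antipode_invM g h : S' (g * h) = S' h * S' g.
Proof.
by apply: (can_inj (@antipodeK k H)); rewrite antipodeM !antipode_invK.
Qed.
Lemma counit_antipode_inv h : ε (S' h) = ε h.
Proof. by rewrite -counit_antipode antipode_invK. Qed.
Lemma comul_antipode_inv h : Δ (S' h) = \sw_(a ⊗ b <- Δ h) (S' b ⊗ S' a).
Proof.
rewrite -[in RHS](antipode_invK h) comul_antipode.
rewrite (lin_tsum (L := fun x => \sw_(a ⊗ b <- x) (S' b ⊗ S' a))); last by lins.
rewrite [LHS]tens_pureE; apply: eq_tsum => a b; rewrite tsum_pure; last by lins.
by rewrite !antipodeK.
Qed.

Definition antipode_pow (n : int) : H -> H :=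
  match n with Posz m => iter m S | Negz m => iter m.+1 S' end.
Notation "S^[ n ]" := (antipode_pow n) (format "S^[ n ]").

Lemma antipode_pow_linear n : linear S^[n].
Proof.
case: n => n a x y /=; last rewrite -linearP; last congr (S' _);
  elim: n => //= n ->; exact: linearP.
Qed.
HB.instance Definition _ n :=
  GRing.isLinear.Build k H H *:%R S^[n] (@antipode_pow_linear n).

Lemma antipode_powS n h : S^[n + 1] h = S (S^[n] h).
Proof.
case: n => [n|[|n]]; first by rewrite -PoszD addn1.
  by rewrite /= antipode_invK.
have -> : Negz n.+1 + 1 = Negz n by rewrite !NegzE -[n.+2]addn1 PoszD opprD subrK.
by rewrite /= antipode_invK.
Qed.
Lemma antipode_powP n h : S^[n - 1] h = S' (S^[n] h).
Proof. by rewrite -{2}[n](subrK 1) antipode_powS antipodeK. Qed.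

Lemma antipode_powD m n h : S^[m + n] h = S^[m] (S^[n] h).
Proof.
elim/int_rec: m => [|m IHm|m IHm]; first by rewrite add0r.
  by rewrite -addn1 PoszD addrAC !antipode_powS IHm.
by rewrite -addn1 PoszD opprD addrAC !antipode_powP IHm.
Qed.
Lemma antipode_pow0 h : S^[0] h = h. Proof. by []. Qed.
Lemma antipode_powK n : cancel S^[n] S^[- n].
Proof. by move=> h; rewrite -antipode_powD addNr. Qed.
Lemma antipode_powVK n : cancel S^[- n] S^[n].
Proof. by move=> h; rewrite -antipode_powD subrr. Qed.

Lemma counit_pow n h : ε (S^[n] h) = ε h.
Proof.
elim/int_rec: n => // n IHn; rewrite -addn1 PoszD ?opprD.
  by rewrite antipode_powS counit_antipode.
by rewrite antipode_powP counit_antipode_inv.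
Qed.
Lemma antipode_pow1 n : S^[n] 1 = 1.
Proof.
elim/int_rec: n => // n IHn; rewrite -addn1 PoszD ?opprD.
  by rewrite antipode_powS IHn antipode1.
by rewrite antipode_powP IHn antipode_inv1.
Qed.

Lemma even_succ (n : nat) : 2 * n.+1%:Z = 2 * n%:Z + 1 + 1.
Proof. by rewrite -[n.+1]addn1 PoszD mulrDr mulr1 -addrA. Qed.
Lemma even_pred (n : nat) : 2 * - n.+1%:Z = 2 * - n%:Z - 1 - 1.
Proof. by rewrite !mulrN even_succ !opprD. Qed.

Lemma antipode_evenM n g h : S^[2 * n] (g * h) = S^[2 * n] g * S^[2 * n] h.
Proof.
elim/int_rec: n => // n IHn.
  by rewrite even_succ !antipode_powS IHn !antipodeM.
by rewrite even_pred !antipode_powP IHn !antipode_invM.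
Qed.

Lemma comul_even n h :
  Δ (S^[2 * n] h) = \sw_(a ⊗ b <- Δ h) (S^[2 * n] a ⊗ S^[2 * n] b).
Proof.
elim/int_rec: n => [|n IHn|n IHn].
- by rewrite mulr0 /= -tens_pureE.
- rewrite even_succ !antipode_powS 2!comul_antipode IHn.
  rewrite (lin_tsum (L := fun x => \sw_(a ⊗ b <- \sw_(c ⊗ d <- x) (S d ⊗ S c))
     (S b ⊗ S a))); last by lins.
  apply: eq_tsum => a b; rewrite !tsum_pure; try by lins.
  by rewrite !antipode_powS.
- rewrite even_pred !antipode_powP 2!comul_antipode_inv IHn.
  rewrite (lin_tsum (L := fun x => \sw_(a ⊗ b <- \sw_(c ⊗ d <- x) (S' d ⊗ S' c))
     (S' b ⊗ S' a))); last by lins.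
  apply: eq_tsum => a b; rewrite !tsum_pure; try by lins.
  by rewrite !antipode_powP.
Qed.

Lemma sw_comul_even U (F : H -> H -> U) n h : bilin F ->
  \sw_(a ⊗ b <- Δ (S^[2 * n] h)) F a b =
  \sw_(a ⊗ b <- Δ h) F (S^[2 * n] a) (S^[2 * n] b).
Proof.
move=> bF; rewrite comul_even (lin_tsum (L := fun x => tsum x F)).
  by apply: eq_tsum => a b; rewrite tsum_pure.
exact: tsum_linear.
Qed.
End HopfTheory.
Arguments antipode_pow {k H} n _.
Notation "S^[ n ]" := (antipode_pow n)
  (at level 0, n at level 200, format "S^[ n ]") : ring_scope.

Record category := Category {
  ob :> Type;
  hom : ob -> ob -> Type;
  idm : forall X, hom X X;
  comp : forall X Y Z, hom Y Z -> hom X Y -> hom X Z;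
  compA : forall X Y Z T (f : hom Z T) (g : hom Y Z) (h : hom X Y),
    comp f (comp g h) = comp (comp f g) h;
  comp1m : forall X Y (f : hom X Y), comp (idm Y) f = f;
  compm1 : forall X Y (f : hom X Y), comp f (idm X) = f
}.
Arguments hom {_} X Y.
Arguments idm {_} X.
Arguments comp {_ X Y Z} f g.
Notation "f ∘ g" := (comp f g) (at level 50, left associativity).

Record functor (C D : category) := Functor {
  fob :> C -> D;
  fmap : forall X Y, hom X Y -> hom (fob X) (fob Y);
  fmap1 : forall X, fmap (idm X) = idm (fob X);
  fmapM : forall X Y Z (f : hom Y Z) (g : hom X Y),
    fmap (f ∘ g) = fmap f ∘ fmap g
}.
Arguments fmap {C D} F {X Y} f : rename.

Definition functor_id (C : category) : functor C C :=
  @Functor C C (fun X => X) (fun X Y f => f) (fun X => erefl)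
    (fun X Y Z f g => erefl).

Section FunctorComp.
Variables (C D E : category) (F : functor D E) (G : functor C D).
Lemma functor_comp1 X : fmap F (fmap G (idm X)) = idm (F (G X)).
Proof. by rewrite !fmap1. Qed.
Lemma functor_compM X Y Z (f : hom Y Z) (g : hom X Y) :
  fmap F (fmap G (f ∘ g)) = fmap F (fmap G f) ∘ fmap F (fmap G g).
Proof. by rewrite !fmapM. Qed.
Definition functor_comp : functor C E :=
  @Functor C E (fun X => F (G X)) (fun X Y f => fmap F (fmap G f))
    functor_comp1 functor_compM.
End FunctorComp.

Record natIso (C D : category) (F G : functor C D) := NatIso {
  iso :> forall X, hom (F X) (G X);
  iso_inv : forall X, hom (G X) (F X);
  iso_natural : forall X Y (f : hom X Y), iso Y ∘ fmap F f = fmap G f ∘ iso X;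
  isoK : forall X, iso_inv X ∘ iso X = idm (F X);
  iso_invK : forall X, iso X ∘ iso_inv X = idm (G X)
}.

Section Actions.
Variables (G : zmodType) (C : category).

Definition functor_cast (F : G -> functor C C) (g h : G) (e : g = h) (X : C) :
    hom (F g X) (F h X) :=
  match e in _ = h' return hom (F g X) (F h' X) with
  | erefl => idm (F g X)
  end.

(* An action of the additively written group G on the category C, i.e. a
   strong monoidal functor from G, seen as a discrete monoidal category, to the
   endofunctors of C. *)
Record groupAction := GroupAction {
  gact :> G -> functor C C;
  gact_unit : natIso (functor_id C) (gact 0);
  gact_mul : forall g h, natIso (functor_comp (gact g) (gact h)) (gact (g + h));
  gact_unitl : forall g X,
    gact_mul 0 g X ∘ gact_unit (gact g X) =
    functor_cast gact (esym (add0r g)) X;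
  gact_unitr : forall g X,
    gact_mul g 0 X ∘ fmap (gact g) (gact_unit X) =
    functor_cast gact (esym (addr0 g)) X;
  gact_assoc : forall f g h X,
    functor_cast gact (addrA f g h) X
      ∘ (gact_mul f (g + h) X ∘ fmap (gact f) (gact_mul g h X)) =
    gact_mul (f + g) h X ∘ gact_mul f g (gact h X)
}.
End Actions.

(* An isomorphism between an action A of G and the pullback of an action B of
   Q along p : G -> Q, compatible with the monoidal structures. *)
Record pullbackIso (G Q : zmodType) (C : category) (p : {additive G -> Q})
    (A : groupAction G C) (B : groupAction Q C) := PullbackIso {
  pbiso :> forall g, natIso (A g) (B (p g));
  pbiso_unit : forall X,
    functor_cast B (raddf0 p) X ∘ (pbiso 0 X ∘ gact_unit A X) = gact_unit B X;
  pbiso_mul : forall g h X,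
    functor_cast B (raddfD p g h) X ∘ (pbiso (g + h) X ∘ gact_mul A g h X) =
    gact_mul B (p g) (p h) X ∘ (pbiso g (B (p h) X) ∘ fmap (A g) (pbiso h X))
}.

(* The group Z/iZ, for every integer i (including 0 and negative i). *)
Definition Zmod (i : int) := Quotient.quot (GRing.ZmodClosed.clone int (dvdz i) _).
HB.instance Definition _ i := GRing.Zmodule.on (Zmod i).
Definition to_Zmod (i a : int) : Zmod i := \pi_(Zmod i)%qT a.

Lemma to_Zmod_is_additive i : zmod_morphism (to_Zmod i).
Proof. by move=> a b; rewrite /to_Zmod raddfB. Qed.
HB.instance Definition _ i :=
  GRing.isZmodMorphism.Build int (Zmod i) (to_Zmod i) (to_Zmod_is_additive i).

Lemma to_ZmodP i a b : (to_Zmod i a == to_Zmod i b) = (i %| a - b)%Z.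
Proof. by rewrite /to_Zmod -Quotient.idealrBE. Qed.

(* s_X corresponds, under the isomorphism between A and the pullback of an
   action of Z/iZ, to the equality of the classes of 0 and -i. The guard i != 0
   is needed: for i = 0 there is nothing to factor, whereas s is then an
   automorphism of the identity functor that need not be trivial. *)
Definition factors_through_Zmod (C : category) (A : groupAction int C) (i : int)
    (s : natIso (functor_id C) (A (- i))) : Prop :=
  exists (B : groupAction (Zmod i) C) (p : pullbackIso (to_Zmod i) A B),
    i != 0 -> forall (e : to_Zmod i 0 = to_Zmod i (- i)) X,
      p (- i) X ∘ s X =
      functor_cast B e X ∘ (p 0 X ∘ gact_unit A X).

Section Modules.
Variables (k : fieldType) (H : hopfAlgebra k).
Notation Δ := (comul H).
Notation ε := (counit H).
Notation S := (antipode H).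

Record is_module (M : lmodType k) (act : H -> M -> M) : Prop := IsModule {
  act_bilin : bilin act;
  act1 : forall m, act 1 m = m;
  actM : forall g h m, act (g * h) m = act g (act h m)
}.

Record is_comodule (M : lmodType k) (coact : {linear M -> tens M H}) : Prop :=
  IsComodule {
  coactA : forall m,
    \sw_(m0 ⊗ m1 <- coact m) \sw_(m00 ⊗ m01 <- coact m0) (m00 ⊗ (m01 ⊗ m1)) =
    \sw_(m0 ⊗ m1 <- coact m) (m0 ⊗ Δ m1);
  coact1 : forall m, \sw_(m0 ⊗ m1 <- coact m) (ε m1 *: m0) = m
}.

Definition contra_linear (N : lmodType k) (α : {linear H -> N} -> N) : Prop :=
  forall (c : k) (f g : {linear H -> N}),
    α (c \*: f \+ g : {linear H -> N}) = c *: α f + α g.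

Lemma slice_linear (N : lmodType k) (f : {linear tens H H -> N}) (x : H) :
  linear (fun h : H => f (x ⊗ h)).
Proof. by lins. Qed.

Lemma contra_slice_linear (N : lmodType k) (α : {linear H -> N} -> N) :
  contra_linear α -> forall f : {linear tens H H -> N},
  linear (fun x => α (mklin (fun h => f (x ⊗ h)) (slice_linear f x))).
Proof.
move=> lα f c x y; rewrite -lα; congr α; apply: linear_ext => h /=.
by rewrite (tpure_bilin _ _).1 linearP.
Qed.

Lemma counit_scale_linear (N : lmodType k) (n : N) :
  linear (fun h : H => ε h *: n).
Proof. by lins. Qed.

Record is_contramodule (N : lmodType k) (α : {linear H -> N} -> N) : Prop :=
  IsContramodule {
  contra_lin : contra_linear α;
  contraA : forall f : {linear tens H H -> N},
    α (mklin (fun x => α (mklin (fun h => f (x ⊗ h)) (slice_linear f x)))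
         (contra_slice_linear contra_lin f)) =
    α (f \o Δ : {linear H -> N});
  contra1 : forall n,
    α (mklin (fun h => ε h *: n) (counit_scale_linear n)) = n
}.

Lemma act_linear (M : lmodType k) (act : H -> M -> M) : is_module act ->
  forall m, linear (fun h => act h m).
Proof. by move=> Hact m; have [] := act_bilin Hact. Qed.

Lemma act_pow_linear (M : lmodType k) (act : H -> M -> M) : is_module act ->
  forall n m, linear (fun h => act (S^[n] h) m).
Proof.
by move=> Hact n m; have [la _] := act_bilin Hact => c x y; rewrite linearP la.
Qed.

Lemma lin_actl (M X : lmodType k) (act : H -> M -> M) (f : X -> H) m :
  is_module act -> linear f -> linear (fun x => act (f x) m).
Proof. by move=> Hact lf c x y; rewrite lf (act_bilin Hact).1. Qed.

Lemma lin_actr (M X : lmodType k) (act : H -> M -> M) (f : X -> M) h :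
  is_module act -> linear f -> linear (fun x => act h (f x)).
Proof. by move=> Hact lf c x y; rewrite lf (act_bilin Hact).2. Qed.

End Modules.

Ltac lins_hook ::= first
  [ apply: lin_actl; [first [eassumption] | lins]
  | apply: lin_actr; [first [eassumption] | lins] ].

Section YetterDrinfeld.
Variables (k : fieldType) (H : hopfAlgebra k).
Notation Δ := (comul H).
Notation S := (antipode H).

Definition contra_conj (j : int) (N : lmodType k) (act : H -> N -> N)
    (h : H) (f : H -> N) : H -> N := fun x =>
  \sw_(h1 ⊗ h23 <- Δ h) \sw_(h2 ⊗ h3 <- Δ h23)
    act h2 (f (S h3 * x * S^[2 - 2 * j] h1)).

Lemma contra_conj_linear j (N : lmodType k) (act : H -> N -> N) h
    (f : {linear H -> N}) : is_module act -> linear (contra_conj j act h f).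
Proof. by move=> Hact; rewrite /contra_conj; lins. Qed.

Record ydModule (j : int) := YDModule {
  ydm_space :> lmodType k;
  ydm_act : H -> ydm_space -> ydm_space;
  ydm_coact : {linear ydm_space -> tens ydm_space H};
  ydm_module : is_module ydm_act;
  ydm_comodule : is_comodule ydm_coact;
  ydm_compat : forall h m, ydm_coact (ydm_act h m) =
    \sw_(h1 ⊗ h23 <- Δ h) \sw_(h2 ⊗ h3 <- Δ h23) \sw_(m0 ⊗ m1 <- ydm_coact m)
      (ydm_act h2 m0 ⊗ (h3 * m1 * S^[- 1 - 2 * j] h1))
}.

Record ydContra (j : int) := YDContra {
  ydc_space :> lmodType k;
  ydc_act : H -> ydc_space -> ydc_space;
  ydc_contra : {linear H -> ydc_space} -> ydc_space;
  ydc_module : is_module ydc_act;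
  ydc_contramodule : is_contramodule ydc_contra;
  ydc_compat : forall h (f : {linear H -> ydc_space}),
    ydc_act h (ydc_contra f) =
    ydc_contra (mklin (contra_conj j ydc_act h f)
                  (contra_conj_linear j h f ydc_module))
}.
End YetterDrinfeld.

Section YDModCategory.
Variables (k : fieldType) (H : hopfAlgebra k) (j : int).
Implicit Types M N P : ydModule H j.

Record ydmHom M N := YDMHom {
  ydm_fun :> {linear M -> N};
  ydm_fun_act : forall h m, ydm_fun (ydm_act h m) = ydm_act h (ydm_fun m);
  ydm_fun_coact : forall m, ydm_coact N (ydm_fun m) =
    \sw_(m0 ⊗ m1 <- ydm_coact M m) (ydm_fun m0 ⊗ m1)
}.

Lemma ydmHom_ext M N (f g : ydmHom M N) : f =1 g -> f = g.
Proof.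
case: f g => f fa fc [g ga gc] /= /linear_ext fg; subst g.
by rewrite (Prop_irrelevance ga fa) (Prop_irrelevance gc fc).
Qed.

Lemma ydm_id_coact M m :
  ydm_coact M m = \sw_(m0 ⊗ m1 <- ydm_coact M m) (m0 ⊗ m1).
Proof. exact: tens_pureE. Qed.

Definition ydm_id M : ydmHom M M :=
  @YDMHom M M (idfun : {linear M -> M}) (fun h m => erefl) (@ydm_id_coact M).

Section Comp.
Variables (M N P : ydModule H j) (f : ydmHom N P) (g : ydmHom M N).
Lemma ydm_comp_act h m : f (g (ydm_act h m)) = ydm_act h (f (g m)).
Proof. by rewrite !ydm_fun_act. Qed.
Lemma ydm_comp_coact m : ydm_coact P (f (g m)) =
  \sw_(m0 ⊗ m1 <- ydm_coact M m) (f (g m0) ⊗ m1).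
Proof.
rewrite ydm_fun_coact ydm_fun_coact.
rewrite (lin_tsum (L := fun x => \sw_(n0 ⊗ n1 <- x) (f n0 ⊗ n1))); last by lins.
by apply: eq_tsum => m0 m1; rewrite tsum_pure //; lins.
Qed.
Definition ydm_comp : ydmHom M P :=
  @YDMHom M P (f \o g : {linear M -> P}) ydm_comp_act ydm_comp_coact.
End Comp.

Definition YDmod : category.
Proof.
refine (@Category (ydModule H j) ydmHom ydm_id ydm_comp _ _ _).
- by move=> *; apply: ydmHom_ext.
- by move=> *; apply: ydmHom_ext.
- by move=> *; apply: ydmHom_ext.
Defined.

Section Twist.
Variables (n : int) (M : ydModule H j).

Definition ydm_twist_act (h : H) (m : M) : M := ydm_act (S^[- (2 * n)] h) m.

Lemma ydm_twist_coact_linear : linear (fun m : M =>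
  \sw_(m0 ⊗ m1 <- ydm_coact M m) (m0 ⊗ S^[2 * n] m1)).
Proof. by lins. Qed.

Definition ydm_twist_coact : {linear M -> tens M H} :=
  mklin (fun m => \sw_(m0 ⊗ m1 <- ydm_coact M m) (m0 ⊗ S^[2 * n] m1))
    ydm_twist_coact_linear.

Lemma sw_ydm_twist (U : lmodType k) (F : M -> H -> U) m : bilin F ->
  tsum (ydm_twist_coact m) F =
  \sw_(m0 ⊗ m1 <- ydm_coact M m) F m0 (S^[2 * n] m1).
Proof.
move=> bF /=; rewrite (lin_tsum (L := fun x => tsum x F)).
  by apply: eq_tsum => m0 m1; rewrite tsum_pure.
exact: tsum_linear.
Qed.

Lemma ydm_twist_module : is_module ydm_twist_act.
Proof.
rewrite /ydm_twist_act; have Hm := ydm_module M.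
split=> [|m|g h m]; first by lins.
  by rewrite antipode_pow1 (act1 Hm).
by rewrite -mulrN antipode_evenM (actM Hm).
Qed.

Lemma sw_coactA (U : lmodType k) (F : M -> H -> H -> U) m :
  [/\ forall b c, linear (fun a => F a b c),
      forall a c, linear (fun b => F a b c) &
      forall a b, linear (fun c => F a b c)] ->
  \sw_(m0 ⊗ m1 <- ydm_coact M m) \sw_(m00 ⊗ m01 <- ydm_coact M m0) F m00 m01 m1 =
  \sw_(m0 ⊗ m1 <- ydm_coact M m) \sw_(a ⊗ b <- comul H m1) F m0 a b.
Proof.
move=> [F1 F2 F3].
have b23 a : bilin (F a) by split=> ?; [apply: F2 | apply: F3].
pose G a y := \sw_(c ⊗ d <- y) F a c d.
have bG : bilin G.
  split=> [y|a]; first by apply: lin_tsumr => c d; apply: F1.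
  exact: tsum_linear.
have lG := tsum_linear bG.
have /(congr1 (fun x => tsum x G)) := coactA (ydm_comodule M) m.
rewrite !(lin_tsum _ _ lG) => E.
transitivity (\sw_(a ⊗ b <- ydm_coact M m)
  tsum (\sw_(a1 ⊗ a2 <- ydm_coact M a) (a1 ⊗ (a2 ⊗ b))) G).
  apply: eq_tsum => a b; rewrite (lin_tsum _ _ lG).
  by apply: eq_tsum => c d; rewrite tsum_pure // /G tsum_pure.
by rewrite E; apply: eq_tsum => a b; rewrite tsum_pure.
Qed.

Lemma ydm_twist_comodule : is_comodule ydm_twist_coact.
Proof.
split=> m.
  rewrite sw_ydm_twist; last by lins.
  rewrite [RHS]sw_ydm_twist; last by lins.
  transitivity (\sw_(m0 ⊗ m1 <- ydm_coact M m)
    \sw_(m00 ⊗ m01 <- ydm_coact M m0)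
    (m00 ⊗ (S^[2 * n] m01 ⊗ S^[2 * n] m1))).
    by apply: eq_tsum => m0 m1; rewrite sw_ydm_twist //; lins.
  rewrite sw_coactA; last by split; lins.
  apply: eq_tsum => m0 m1; rewrite comul_even.
  by rewrite (lin_tsum (L := fun x => m0 ⊗ x)) //; lins.
rewrite sw_ydm_twist; last by lins.
rewrite -[RHS](coact1 (ydm_comodule M)).
by apply: eq_tsum => m0 m1; rewrite counit_pow.
Qed.

Lemma ydm_twist_compat h m : ydm_twist_coact (ydm_twist_act h m) =
  \sw_(h1 ⊗ h23 <- comul H h) \sw_(h2 ⊗ h3 <- comul H h23)
  \sw_(m0 ⊗ m1 <- ydm_twist_coact m)
      (ydm_twist_act h2 m0 ⊗ (h3 * m1 * S^[- 1 - 2 * j] h1)).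
Proof.
have Hm := ydm_module M.
rewrite /= /ydm_twist_act ydm_compat.
pose L (x : tens M H) := \sw_(m0 ⊗ m1 <- x) (m0 ⊗ S^[2 * n] m1).
have lL : linear L by rewrite /L; lins.
rewrite -[LHS]/(L _) -mulrN sw_comul_even; last by lins.
rewrite (lin_tsum _ _ lL); apply: eq_tsum => h1 h23.
rewrite sw_comul_even; last by lins.
rewrite (lin_tsum _ _ lL); apply: eq_tsum => h2 h3.
rewrite (lin_tsum _ _ lL) [RHS]sw_ydm_twist; last by lins.
apply: eq_tsum => m0 m1; rewrite /L tsum_pure; last by lins.
rewrite !antipode_evenM; congr (_ ⊗ (_ * _ * _)).
  by rewrite mulrN antipode_powVK.
by rewrite -!antipode_powD mulrN addrC addKr.
Qed.

Definition ydm_twist : ydModule H j :=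
  @YDModule k H j M ydm_twist_act ydm_twist_coact
    ydm_twist_module ydm_twist_comodule ydm_twist_compat.
End Twist.

Section TwistMap.
Variables (n : int) (M N : ydModule H j) (f : ydmHom M N).

Lemma ydm_twist_map_act h m :
  f (ydm_twist_act n h m) = ydm_twist_act n h (f m).
Proof. exact: ydm_fun_act. Qed.

Lemma ydm_twist_map_coact m : ydm_twist_coact n N (f m) =
  \sw_(m0 ⊗ m1 <- ydm_twist_coact n M m) (f m0 ⊗ m1).
Proof.
rewrite sw_ydm_twist /= ?ydm_fun_coact; last by lins.
rewrite (lin_tsum (L := fun x => \sw_(m0 ⊗ m1 <- x) (m0 ⊗ S^[2 * n] m1)));
  last by lins.
by apply: eq_tsum => m0 m1; rewrite tsum_pure //; lins.
Qed.

Definition ydm_twist_map : ydmHom (ydm_twist n M) (ydm_twist n N) :=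
  @YDMHom (ydm_twist n M) (ydm_twist n N) f
    ydm_twist_map_act ydm_twist_map_coact.
End TwistMap.

Definition ydm_twist_functor (n : int) : functor YDmod YDmod.
Proof.
refine (@Functor YDmod YDmod (ydm_twist n) (@ydm_twist_map n) _ _).
- by move=> M; apply: ydmHom_ext.
- by move=> *; apply: ydmHom_ext.
Defined.

Section TwistAction.
Variable M : ydModule H j.

Lemma ydm_twist0_act h m : ydm_act h m = ydm_twist_act 0 h m :> M.
Proof. by rewrite /ydm_twist_act mulr0 oppr0. Qed.
Lemma ydm_twist0_coact m : ydm_twist_coact 0 M m = ydm_coact M m.
Proof. by rewrite [RHS]tens_pureE; apply: eq_tsum => m0 m1; rewrite mulr0. Qed.

Lemma ydm_twistD_act g h x (m : M) :
  ydm_act (x : H) (m : ydm_twist g (ydm_twist h M)) = ydm_twist_act (g + h) x m.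
Proof. by rewrite /= /ydm_twist_act /= /ydm_twist_act -antipode_powD -opprD -mulrDr addrC. Qed.
Lemma ydm_twistD_coact g h (m : M) :
  ydm_twist_coact (g + h) M m = ydm_coact (ydm_twist g (ydm_twist h M)) m.
Proof.
rewrite [RHS](sw_ydm_twist (M := M) h); last by lins.
by apply: eq_tsum => m0 m1; rewrite -antipode_powD mulrDr.
Qed.
End TwistAction.


Definition ydm_unit_iso : natIso (functor_id YDmod) (ydm_twist_functor 0).
Proof.
unshelve refine (@NatIso _ _ (functor_id YDmod) (ydm_twist_functor 0) _ _ _ _ _).
- move=> M; refine (@YDMHom M (ydm_twist 0 M) (idfun : {linear M -> M}) _ _).
  + exact: ydm_twist0_act.
  + by move=> m; rewrite [LHS]ydm_twist0_coact [LHS]tens_pureE.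
- move=> M; refine (@YDMHom (ydm_twist 0 M) M (idfun : {linear M -> M}) _ _).
  + by move=> h m; rewrite [RHS]ydm_twist0_act.
  + by move=> m; rewrite -[LHS]ydm_twist0_coact [LHS]tens_pureE.
- by move=> *; apply: ydmHom_ext.
- by move=> *; apply: ydmHom_ext.
- by move=> *; apply: ydmHom_ext.
Defined.

Definition ydm_mul_iso g h :
  natIso (functor_comp (ydm_twist_functor g) (ydm_twist_functor h))
         (ydm_twist_functor (g + h)).
Proof.
unshelve refine (@NatIso _ _ (functor_comp (ydm_twist_functor g) (ydm_twist_functor h))
         (ydm_twist_functor (g + h)) _ _ _ _ _).
- move=> M; refine (@YDMHom (ydm_twist g (ydm_twist h M)) (ydm_twist (g + h) M)
    (idfun : {linear M -> M}) _ _).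
  + by move=> x m; apply: (@ydm_twistD_act M).
  + by move=> m; rewrite [LHS](@ydm_twistD_coact M) [LHS]tens_pureE.
- move=> M; refine (@YDMHom (ydm_twist (g + h) M) (ydm_twist g (ydm_twist h M))
    (idfun : {linear M -> M}) _ _).
  + by move=> x m; rewrite [RHS](@ydm_twistD_act M).
  + by move=> m; rewrite -[LHS](@ydm_twistD_coact M) [LHS]tens_pureE.
- by move=> *; apply: ydmHom_ext.
- by move=> *; apply: ydmHom_ext.
- by move=> *; apply: ydmHom_ext.
Defined.

Lemma ydm_castE g h (e : g = h) (M : ydModule H j) (m : M) :
  (functor_cast ydm_twist_functor e M : ydmHom _ _) m = m.
Proof. by case: _ / e. Qed.

Definition YDmod_action : groupAction int YDmod.
Proof.
refine (@GroupAction int YDmod ydm_twist_functor ydm_unit_iso ydm_mul_iso _ _ _).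
- by move=> g M; apply: ydmHom_ext => m; rewrite ydm_castE.
- by move=> g M; apply: ydmHom_ext => m; rewrite ydm_castE.
- by move=> f g h M; apply: ydmHom_ext => m /=; rewrite ydm_castE.
Defined.
End YDModCategory.

Section YDContraCategory.
Variables (k : fieldType) (H : hopfAlgebra k) (j : int).
Implicit Types M N P : ydContra H j.

Record ydcHom M N := YDCHom {
  ydc_fun :> {linear M -> N};
  ydc_fun_act : forall h m, ydc_fun (ydc_act h m) = ydc_act h (ydc_fun m);
  ydc_fun_contra : forall f : {linear H -> M},
    ydc_fun (ydc_contra f) = ydc_contra (ydc_fun \o f : {linear H -> N})
}.

Lemma ydcHom_ext M N (f g : ydcHom M N) : f =1 g -> f = g.
Proof.
case: f g => f fa fc [g ga gc] /= /linear_ext fg; subst g.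
by rewrite (Prop_irrelevance ga fa) (Prop_irrelevance gc fc).
Qed.

Lemma ydc_id_contra M (f : {linear H -> M}) :
  ydc_contra f = ydc_contra (idfun \o f : {linear H -> M}).
Proof. by congr ydc_contra; apply: linear_ext. Qed.

Definition ydc_id M : ydcHom M M :=
  @YDCHom M M (idfun : {linear M -> M}) (fun h m => erefl) (@ydc_id_contra M).

Section Comp.
Variables (M N P : ydContra H j) (f : ydcHom N P) (g : ydcHom M N).
Lemma ydc_comp_act h m : f (g (ydc_act h m)) = ydc_act h (f (g m)).
Proof. by rewrite !ydc_fun_act. Qed.
Lemma ydc_comp_contra (x : {linear H -> M}) :
  f (g (ydc_contra x)) = ydc_contra ((f \o g) \o x : {linear H -> P}).
Proof.
by rewrite !ydc_fun_contra; congr ydc_contra; apply: linear_ext.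
Qed.
Definition ydc_comp : ydcHom M P :=
  @YDCHom M P (f \o g : {linear M -> P}) ydc_comp_act ydc_comp_contra.
End Comp.

Definition YDctrmd : category.
Proof.
refine (@Category (ydContra H j) ydcHom ydc_id ydc_comp _ _ _).
- by move=> *; apply: ydcHom_ext.
- by move=> *; apply: ydcHom_ext.
- by move=> *; apply: ydcHom_ext.
Defined.

Section Twist.
Variables (n : int) (N : ydContra H j).

Definition ydc_twist_act (h : H) (m : N) : N := ydc_act (S^[- (2 * n)] h) m.
Definition ydc_twist_contra (f : {linear H -> N}) : N :=
  ydc_contra (f \o S^[2 * n] : {linear H -> N}).

Lemma ydc_twist_module : is_module ydc_twist_act.
Proof.
rewrite /ydc_twist_act; have Hm := ydc_module N.
split=> [|m|g h m]; first by lins.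
  by rewrite antipode_pow1 (act1 Hm).
by rewrite -mulrN antipode_evenM (actM Hm).
Qed.

Lemma ydc_twist_contramodule : is_contramodule ydc_twist_contra.
Proof.
have HN := ydc_contramodule N.
have lin : contra_linear ydc_twist_contra.
  move=> c f g; rewrite /ydc_twist_contra -(contra_lin HN).
  by congr ydc_contra; apply: linear_ext.
exists lin => [f|m].
  have l2 : linear (fun y : tens H H =>
      f (\sw_(a ⊗ b <- y) (S^[2 * n] a ⊗ S^[2 * n] b))) by lins.
  have := contraA HN (mklin _ l2); rewrite /ydc_twist_contra => E.
  transitivity (ydc_contra (mklin _ l2 \o comul H : {linear H -> N})).
    rewrite -E; congr ydc_contra; apply: linear_ext => x /=.
    congr ydc_contra; apply: linear_ext => h /=.
    by rewrite tsum_pure //; lins.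
  by congr ydc_contra; apply: linear_ext => h /=; rewrite comul_even.
rewrite -[RHS](contra1 HN) /ydc_twist_contra.
by congr ydc_contra; apply: linear_ext => h /=; rewrite counit_pow.
Qed.

Lemma ydc_twist_compat h (f : {linear H -> N}) :
  ydc_twist_act h (ydc_twist_contra f) =
  ydc_twist_contra (mklin (contra_conj j ydc_twist_act h f)
                      (contra_conj_linear j h f ydc_twist_module)).
Proof.
have Hm := ydc_module N.
rewrite /ydc_twist_act /ydc_twist_contra ydc_compat.
congr ydc_contra; apply: linear_ext => x /=; rewrite /contra_conj.
rewrite -mulrN sw_comul_even; last by lins.
apply: eq_tsum => h1 h23.
rewrite sw_comul_even; last by lins.
apply: eq_tsum => h2 h3; rewrite /= !antipode_evenM.
congr (ydc_act _ (f (_ * _ * _))).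
  have SC m g : antipode H (S^[m] g) = S^[m] (antipode H g).
    by rewrite -antipode_powS antipode_powD.
  by rewrite SC mulrN antipode_powVK.
by rewrite -!antipode_powD mulrN addrC addKr.
Qed.

Definition ydc_twist : ydContra H j :=
  @YDContra k H j N ydc_twist_act ydc_twist_contra
    ydc_twist_module ydc_twist_contramodule ydc_twist_compat.
End Twist.

Section TwistMap.
Variables (n : int) (M N : ydContra H j) (f : ydcHom M N).

Lemma ydc_twist_map_act h m :
  f (ydc_twist_act n h m) = ydc_twist_act n h (f m).
Proof. exact: ydc_fun_act. Qed.

Lemma ydc_twist_map_contra (x : {linear H -> M}) :
  f (ydc_twist_contra n x) = ydc_twist_contra n (f \o x : {linear H -> N}).
Proof.
rewrite /ydc_twist_contra ydc_fun_contra.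
by congr ydc_contra; apply: linear_ext.
Qed.

Definition ydc_twist_map : ydcHom (ydc_twist n M) (ydc_twist n N) :=
  @YDCHom (ydc_twist n M) (ydc_twist n N) f
    ydc_twist_map_act ydc_twist_map_contra.
End TwistMap.

Definition ydc_twist_functor (n : int) : functor YDctrmd YDctrmd.
Proof.
refine (@Functor YDctrmd YDctrmd (ydc_twist n) (@ydc_twist_map n) _ _).
- by move=> M; apply: ydcHom_ext.
- by move=> *; apply: ydcHom_ext.
Defined.

Section TwistAction.
Variable N : ydContra H j.

Lemma ydc_twist0_act h m : ydc_act h m = ydc_twist_act 0 h m :> N.
Proof. by rewrite /ydc_twist_act mulr0 oppr0. Qed.
Lemma ydc_twist0_contra (x : {linear H -> N}) :
  ydc_contra x = ydc_twist_contra 0 (idfun \o x : {linear H -> N}).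
Proof. by congr ydc_contra; apply: linear_ext. Qed.
Lemma ydc_twist0_contraV (x : {linear H -> N}) :
  ydc_twist_contra 0 x = ydc_contra (idfun \o x : {linear H -> N}).
Proof. by congr ydc_contra; apply: linear_ext. Qed.

Lemma ydc_twistD_act g h x (m : N) :
  ydc_act (x : H) (m : ydc_twist g (ydc_twist h N)) = ydc_twist_act (g + h) x m.
Proof.
by rewrite /= /ydc_twist_act /= /ydc_twist_act -antipode_powD -opprD -mulrDr addrC.
Qed.
Lemma ydc_twistD_contra g h (x : {linear H -> N}) :
  ydc_contra (x : {linear H -> ydc_twist g (ydc_twist h N)}) =
  ydc_twist_contra (g + h) (idfun \o x : {linear H -> N}).
Proof.
apply: (congr1 (@ydc_contra k H j N)); apply: linear_ext => y /=.
by rewrite -antipode_powD mulrDr.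
Qed.
Lemma ydc_twistD_contraV g h (x : {linear H -> N}) :
  ydc_twist_contra (g + h) x =
  ydc_contra (idfun \o x : {linear H -> ydc_twist g (ydc_twist h N)}).
Proof.
apply: (congr1 (@ydc_contra k H j N)); apply: linear_ext => y /=.
by rewrite -antipode_powD mulrDr.
Qed.
End TwistAction.

Definition ydc_unit_iso : natIso (functor_id YDctrmd) (ydc_twist_functor 0).
Proof.
unshelve refine
  (@NatIso _ _ (functor_id YDctrmd) (ydc_twist_functor 0) _ _ _ _ _).
- move=> M; refine (@YDCHom M (ydc_twist 0 M) (idfun : {linear M -> M}) _ _).
  + exact: ydc_twist0_act.
  + exact: ydc_twist0_contra.
- move=> M; refine (@YDCHom (ydc_twist 0 M) M (idfun : {linear M -> M}) _ _).
  + by move=> h m; rewrite [RHS]ydc_twist0_act.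
  + by move=> x; exact: (ydc_twist0_contraV (x : {linear H -> M})).
- by move=> *; apply: ydcHom_ext.
- by move=> *; apply: ydcHom_ext.
- by move=> *; apply: ydcHom_ext.
Defined.

Definition ydc_mul_iso g h :
  natIso (functor_comp (ydc_twist_functor g) (ydc_twist_functor h))
         (ydc_twist_functor (g + h)).
Proof.
unshelve refine
  (@NatIso _ _ (functor_comp (ydc_twist_functor g) (ydc_twist_functor h))
     (ydc_twist_functor (g + h)) _ _ _ _ _).
- move=> M; refine (@YDCHom (ydc_twist g (ydc_twist h M)) (ydc_twist (g + h) M)
    (idfun : {linear M -> M}) _ _).
  + by move=> x m; apply: (@ydc_twistD_act M).
  + by move=> x; apply: (@ydc_twistD_contra M).
- move=> M; refine (@YDCHom (ydc_twist (g + h) M) (ydc_twist g (ydc_twist h M))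
    (idfun : {linear M -> M}) _ _).
  + by move=> x m; rewrite [RHS](@ydc_twistD_act M).
  + by move=> x; apply: (@ydc_twistD_contraV M).
- by move=> *; apply: ydcHom_ext.
- by move=> *; apply: ydcHom_ext.
- by move=> *; apply: ydcHom_ext.
Defined.

Lemma ydc_castE g h (e : g = h) (M : ydContra H j) (m : M) :
  (functor_cast ydc_twist_functor e M : ydcHom _ _) m = m.
Proof. by case: _ / e. Qed.

Definition YDctrmd_action : groupAction int YDctrmd.
Proof.
refine (@GroupAction int YDctrmd ydc_twist_functor ydc_unit_iso ydc_mul_iso _ _ _).
- by move=> g M; apply: ydcHom_ext => m; rewrite ydc_castE.
- by move=> g M; apply: ydcHom_ext => m; rewrite ydc_castE.
- by move=> f g h M; apply: ydcHom_ext => m /=; rewrite ydc_castE.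
Defined.
End YDContraCategory.

(* Main.v *)
From mathcomp Require Import all_boot all_order all_algebra ring.
From mathcomp Require Import boolp.
Require Import Defs.
Set Implicit Arguments.
Unset Strict Implicit.
Unset Printing Implicit Defensive.
Import GRing.Theory.
Local Open Scope ring_scope.

(* The compatibility condition makes σ semilinear, σ(hm) = S^{2i}(h) σ(m), and
   gives ρ(σ(m)) = σ(m_0) ⊗ S^{2i}(m_1); dually for contramodules. Hence σ is a
   morphism to the twist by -i, and S^{-1}(h^2) h^1 = ε(h) = h^2 S^{-1}(h^1)
   shows that the stated maps are inverse to it. As a linear map, σ is the same
   for an object and for its twists, so the powers of σ are coherent
   isomorphisms between the twists by g and by h whenever i divides g - h; an
   action of Z/iZ is then obtained by twisting with chosen representatives of
   the classes, with the powers of σ as structure maps. *)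

(** * Descent of a group action along a surjection *)

(* What it takes for an action of G to factor through p : G -> Q up to
   isomorphism: coherent identifications of the functors attached to elements
   with the same image under p. *)
Record descentDatum (G Q : zmodType) (C : category) (p : {additive G -> Q})
    (A : groupAction G C) := DescentDatum {
  descent :> forall g h, p g = p h -> forall X, hom (A g X) (A h X);
  descent_natural : forall g h (e : p g = p h) X Y (f : hom X Y),
    descent e Y ∘ fmap (A g) f = fmap (A h) f ∘ descent e X;
  descent_id : forall g (e : p g = p g) X, descent e X = idm (A g X);
  descent_comp : forall f g h (d : p f = p g) (e : p g = p h) (de : p f = p h) X,
    descent e X ∘ descent d X = descent de X;
  descent_mul : forall g g' h h' (d : p g = p g') (e : p h = p h')
      (de : p (g + h) = p (g' + h')) X,
    gact_mul A g' h' X ∘ (descent d (A h' X) ∘ fmap (A g) (descent e X)) =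
    descent de X ∘ gact_mul A g h X
}.

Definition natIso_comp (C D : category) (F G K : functor C D)
  (t : natIso G K) (s : natIso F G) : natIso F K.
Proof.
refine (@NatIso _ _ F K (fun X => t X ∘ s X)
  (fun X => iso_inv s X ∘ iso_inv t X) _ _ _).
- by move=> X Y f /=; rewrite -compA iso_natural compA iso_natural -compA.
- by move=> X /=; rewrite compA -(compA (iso_inv s X)) isoK compm1 isoK.
- by move=> X /=; rewrite compA -(compA (t X)) iso_invK compm1 iso_invK.
Defined.

Section Descent.
Variables (G Q : zmodType) (C : category) (p : {additive G -> Q}).
Variables (A : groupAction G C) (φ : descentDatum p A).
Variables (r : Q -> G) (rK : cancel r p).

Definition descent_iso g h (e : p g = p h) : natIso (A g) (A h).
Proof.
refine (@NatIso _ _ (A g) (A h) (φ g h e) (φ h g (esym e)) _ _ _) => [*|X|X].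
- exact: descent_natural.
- by rewrite (descent_comp _ _ _ (erefl (p g))) descent_id.
- by rewrite (descent_comp _ _ _ (erefl (p h))) descent_id.
Defined.

(** Casts in the laws of an action are themselves identifications, so they merge with [φ] by
    [descent_comp]. *)
Lemma descent_cast g h (e : g = h) (pe : p g = p h) X :
  functor_cast A e X = φ g h pe X.
Proof. by case: _ / e pe => pe; rewrite descent_id. Qed.

Lemma descent_castr (a b : Q) (e : a = b) (re : p (r a) = p (r b)) X :
  functor_cast (fun q => A (r q)) e X = φ (r a) (r b) re X.
Proof. by case: _ / e re => re; rewrite descent_id. Qed.

Lemma section0 : p 0 = p (r 0). Proof. by rewrite rK raddf0. Qed.
Lemma sectionD a b : p (r a + r b) = p (r (a + b)).
Proof. by rewrite raddfD !rK. Qed.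

(** [r] need not be additive, so the structure maps of [A] are corrected by [φ]. *)
Definition descent_unit : natIso (functor_id C) (A (r 0)) :=
  natIso_comp (descent_iso section0) (gact_unit A).
Definition descent_gmul a b :
    natIso (functor_comp (A (r a)) (A (r b))) (A (r (a + b))) :=
  natIso_comp (descent_iso (sectionD a b)) (gact_mul A (r a) (r b)).

Lemma descent_unitE X : descent_unit X = φ _ _ section0 X ∘ gact_unit A X.
Proof. by []. Qed.
Lemma descent_gmulE a b X :
  descent_gmul a b X = φ _ _ (sectionD a b) X ∘ gact_mul A (r a) (r b) X.
Proof. by []. Qed.

(** [descent_mul] with an identity in the other slot: [φ] slides past the multiplication one
    variable at a time. *)
Lemma descent_mull g g' h (d : p g = p g') (de : p (g + h) = p (g' + h)) X :
  gact_mul A g' h X ∘ φ g g' d (A h X) = φ _ _ de X ∘ gact_mul A g h X.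
Proof.
by rewrite -(descent_mul φ d (erefl (p h))) descent_id fmap1 compm1.
Qed.
Lemma descent_mulr g h h' (e : p h = p h') (de : p (g + h) = p (g + h')) X :
  gact_mul A g h' X ∘ fmap (A g) (φ h h' e X) = φ _ _ de X ∘ gact_mul A g h X.
Proof.
by rewrite -(descent_mul φ (erefl (p g)) e) descent_id comp1m.
Qed.

(** Pushing every [φ] to the left of the structure maps of [A] reduces each law to the same law for
    [A], up to one composite [φ]. *)
Definition descent_action : groupAction Q C.
Proof.
refine (@GroupAction Q C (fun q => A (r q)) descent_unit descent_gmul _ _ _).
- move=> q X.
  have e : p (0 + r q) = p (r 0 + r q) by rewrite !raddfD -section0.
  have e' : p (r q) = p (0 + r q) by rewrite add0r.
  have e2 : p (0 + r q) = p (r (0 + q)) by rewrite !add0r.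
  have e3 : p (r q) = p (r (0 + q)) by rewrite add0r.
  rewrite descent_gmulE descent_unitE -compA (compA (gact_mul _ _ _ _)).
  rewrite (descent_mull _ e) -compA gact_unitl (descent_cast _ e') compA.
  by rewrite (descent_comp _ _ _ e2) (descent_comp _ _ _ e3) (descent_castr _ e3).
- move=> q X.
  have e : p (r q + 0) = p (r q + r 0) by rewrite !raddfD -section0.
  have e' : p (r q) = p (r q + 0) by rewrite addr0.
  have e2 : p (r q + 0) = p (r (q + 0)) by rewrite !addr0.
  have e3 : p (r q) = p (r (q + 0)) by rewrite addr0.
  rewrite descent_gmulE descent_unitE fmapM -compA (compA (gact_mul _ _ _ _)).
  rewrite (descent_mulr _ e) -compA gact_unitr (descent_cast _ e') compA.
  by rewrite (descent_comp _ _ _ e2) (descent_comp _ _ _ e3) (descent_castr _ e3).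
- move=> f g h X; rewrite !descent_gmulE.
  (* Both sides become [φ] at [e6] after the right-nested product of [r f], [r g], [r h]; the other
     equalities index the intermediate identifications. *)
  have e1 : p (r f + (r g + r h)) = p (r f + r (g + h)).
    by rewrite !raddfD !rK.
  have e2 : p ((r f + r g) + r h) = p (r (f + g) + r h).
    by rewrite !raddfD !rK.
  have e3 : p (r (f + (g + h))) = p (r (f + g + h)) by rewrite !rK addrA.
  have e4 : p (r f + (r g + r h)) = p (r f + r g + r h) by rewrite addrA.
  have e5 : p (r f + (r g + r h)) = p (r (f + (g + h))) by rewrite e1 sectionD.
  have e6 : p (r f + (r g + r h)) = p (r (f + g + h)) by rewrite e5.
  have e7 : p (r f + r g + r h) = p (r (f + g + h)) by rewrite -e6 addrA.
  rewrite (descent_castr _ e3) fmapM (compA (_ ∘ _) (fmap (A (r f)) _)).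
  rewrite -[Z in _ ∘ (Z ∘ _)]compA (descent_mulr _ e1).
  rewrite [Z in _ ∘ (Z ∘ _)]compA (descent_comp _ _ _ e5) -[Z in _ ∘ Z]compA.
  rewrite [LHS]compA (descent_comp _ _ _ e6).
  rewrite [RHS]compA -[Z in _ = Z ∘ _]compA (descent_mull _ e2).
  rewrite [Z in _ = Z ∘ _]compA (descent_comp _ _ _ e7) -[RHS]compA -gact_assoc.
  by rewrite (descent_cast _ e4) [RHS]compA (descent_comp _ _ _ e6).
Defined.

Lemma section_class g : p g = p (r (p g)). Proof. by rewrite rK. Qed.

Definition descent_pullback : pullbackIso p A descent_action.
Proof.
refine (@PullbackIso G Q C p A descent_action
  (fun g => descent_iso (section_class g)) _ _).
- move=> X /=.
  have e : p (r (p 0)) = p (r 0) by rewrite raddf0.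
  by rewrite (descent_castr _ e) compA (descent_comp _ _ _ section0).
- move=> g h X /=.
  have e : p (r (p (g + h))) = p (r (p g + p h)) by rewrite raddfD.
  have e1 : p (g + h) = p (r (p g + p h)) by rewrite rK raddfD.
  have e2 : p (g + h) = p (r (p g) + r (p h)) by rewrite !raddfD !rK.
  rewrite (descent_castr _ e) compA (descent_comp _ _ _ e1).
  by rewrite -compA (descent_mul _ _ _ e2) compA (descent_comp _ _ _ e1).
Defined.
End Descent.

(** Up to the unit, [s] is the identification of 0 with [- i], so the required equation is an
    instance of [descent_comp]. *)
Lemma descent_factors (C : category) (A : groupAction int C) (i : int)
    (s : natIso (functor_id C) (A (- i))) (φ : descentDatum (to_Zmod i) A) :
  (i != 0 -> forall (e : to_Zmod i 0 = to_Zmod i (- i)) X,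
     s X = φ _ _ e X ∘ gact_unit A X) ->
  factors_through_Zmod s.
Proof.
move=> sE.
pose r (q : Zmod i) : int := repr q.
have rK : cancel r (to_Zmod i) by move=> q; exact: reprK.
exists (descent_action φ rK), (descent_pullback φ rK) => i0 e X.
have e1 : to_Zmod i (r (to_Zmod i 0)) = to_Zmod i (r (to_Zmod i (- i))).
  by rewrite !rK.
have e2 : to_Zmod i 0 = to_Zmod i (r (to_Zmod i (- i))) by rewrite !rK.
rewrite /= (sE i0 e) compA (descent_comp _ _ _ e2).
by rewrite (descent_castr φ (r := r) _ e1) compA (descent_comp _ _ _ e2).
Qed.

(** * Iteration and antipode identities *)

Section IntegerIteration.
Variables (T : Type) (f g : T -> T).
Hypotheses (fK : cancel f g) (gK : cancel g f).

Definition ziter (c : int) : T -> T :=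
  match c with Posz n => iter n f | Negz n => iter n.+1 g end.

Lemma ziterS c x : ziter (c + 1) x = f (ziter c x).
Proof.
case: c => [n|[|n]]; first by rewrite -PoszD addn1.
  by rewrite /= gK.
have -> : Negz n.+1 + 1 = Negz n by rewrite !NegzE -[n.+2]addn1 PoszD opprD subrK.
by rewrite /= gK.
Qed.
Lemma ziterP c x : ziter (c - 1) x = g (ziter c x).
Proof. by rewrite -{2}[c](subrK 1) ziterS fK. Qed.

Lemma ziterD c d x : ziter (c + d) x = ziter c (ziter d x).
Proof.
elim/int_rec: c => [|c IHc|c IHc]; first by rewrite add0r.
  by rewrite -addn1 PoszD addrAC !ziterS IHc.
by rewrite -addn1 PoszD opprD addrAC !ziterP IHc.
Qed.

(** Writing [1 + c] and [-1 + c] makes degrees add in the order of the compositions; [P] will say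
    that a map is a shift of degree [c * i]. *)
Lemma ziter_rec (P : int -> (T -> T) -> Prop) :
  P 0 id -> (forall c u, P c u -> P (1 + c) (f \o u)) ->
  (forall c u, P c u -> P (-1 + c) (g \o u)) -> forall c, P c (ziter c).
Proof.
move=> P0 Pf Pg [n|n]; elim: n => [//|n IHn].
- by rewrite -add1n PoszD; exact: Pf.
- exact: Pg P0.
by have -> : Negz n.+1 = -1 + Negz n by []; exact: Pg.
Qed.
End IntegerIteration.

(** Serves for naturality of the powers of σ and, with [u] the identity, for comparing σ on an
    object and on its twists. *)
Lemma ziter_conj (T T' : Type) (f g : T -> T) (f' g' : T' -> T') (u : T -> T') c x :
  (forall x, u (f x) = f' (u x)) -> (forall x, u (g x) = g' (u x)) ->
  u (ziter f g c x) = ziter f' g' c (u x).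
Proof.
by move=> uf ug; case: c => n /=; [|rewrite ug; congr g']; elim: n => //= n <-.
Qed.

Lemma sub_shift (i c g h : int) : g = c * i + h -> h = - c * i + g.
Proof. by move=> ->; rewrite mulNr addKr. Qed.

(** Gives the exponent of σ as a function of [g] and [h] alone, so coherence reduces to additivity
    of exact division. *)
Lemma Zmod_quot (i g h : int) : to_Zmod i g = to_Zmod i h ->
  g = ((g - h) %/ i)%Z * i + h.
Proof. by move/eqP; rewrite to_ZmodP => /divzK ->; rewrite subrK. Qed.

(** * Cancellation with the inverse antipode *)

Section HopfExtra.
Variables (k : fieldType) (H : hopfAlgebra k).
Notation Δ := (comul H).
Notation ε := (counit H).
Notation S := (antipode H).

Lemma antipode_powSr n (h : H) : S^[n] (S h) = S^[n + 1] h.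
Proof. by rewrite antipode_powD. Qed.

(** Applying the injective antimultiplicative [S] turns [S^[- 1] b * a] into [S a * b]; likewise for
    the next identity. *)
Lemma antipode_inv_mull (h : H) :
  \sw_(a ⊗ b <- Δ h) (S^[- 1] b * a) = (ε h)%:A.
Proof.
apply: (can_inj (@antipodeK k H)); rewrite linearZ /= antipode1 -antipodel.
rewrite (lin_tsum (L := S)); last by lins.
by apply: eq_tsum => a b; rewrite antipodeM antipode_invK.
Qed.
Lemma antipode_inv_mulr (h : H) :
  \sw_(a ⊗ b <- Δ h) (b * S^[- 1] a) = (ε h)%:A.
Proof.
apply: (can_inj (@antipodeK k H)); rewrite linearZ /= antipode1 -antipoder.
rewrite (lin_tsum (L := S)); last by lins.
by apply: eq_tsum => a b; rewrite antipodeM antipode_invK.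
Qed.

(** Performs any of the four antipode cancellations inside a linear expression [F]. *)
Lemma sw_cancel (U : lmodType k) (m : H -> H -> H) (F : H -> U) (h : H) :
  (\sw_(a ⊗ b <- Δ h) m a b = (ε h)%:A) -> linear F ->
  \sw_(a ⊗ b <- Δ h) F (m a b) = ε h *: F 1.
Proof. by move=> E lF; rewrite -(lin_tsum _ _ lF) E (linZ lF). Qed.
End HopfExtra.

(** * Yetter-Drinfeld modules *)

Section ModuleSigma.
Variables (k : fieldType) (H : hopfAlgebra k) (i j : int) (ij : j = i - 1).
Notation Δ := (comul H).
Notation ε := (counit H).
Notation S := (antipode H).

Section Object.
Variable M : ydModule H j.
Let Hm := ydm_module M.

Definition ydm_sigma (m : M) : M :=
  \sw_(m0 ⊗ m1 <- ydm_coact M m) ydm_act (S^[2 * i] m1) m0.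
Definition ydm_sigma_inv (m : M) : M :=
  \sw_(m0 ⊗ m1 <- ydm_coact M m) ydm_act (S^[- 1] m1) m0.

Lemma ydm_sigma_linear : linear ydm_sigma.
Proof. by rewrite /ydm_sigma; lins. Qed.

(** This is where the index $i-1$ enters: $S^{2i}$ turns $S^{1-2i}$ into $S$. *)
Lemma ydm_expE : - 1 - 2 * j = 1 - 2 * i.
Proof. by rewrite ij; ring. Qed.

(** Compatibility gives $S^{2i}(h^3)S^{2i}(m_1)S(h^1)h^2m_0$, in which $S(h^1)h^2$ collapses. *)
Lemma ydm_sigma_act h m :
  ydm_sigma (ydm_act h m) = ydm_act (S^[2 * i] h) (ydm_sigma m).
Proof.
rewrite /ydm_sigma ydm_compat ydm_expE.
pose L (x : M ⊗ H) := \sw_(m0 ⊗ m1 <- x) ydm_act (S^[2 * i] m1) m0.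
have lL : linear L by rewrite /L; lins.
rewrite -[LHS]/(L _) (lin_tsum _ _ lL).
transitivity (\sw_(h1 ⊗ h23 <- Δ h) \sw_(h2 ⊗ h3 <- Δ h23)
  \sw_(m0 ⊗ m1 <- ydm_coact M m)
    ydm_act (S^[2 * i] h3 * S^[2 * i] m1 * (S h1 * h2)) m0).
  apply: eq_tsum => h1 h23; rewrite (lin_tsum _ _ lL).
  apply: eq_tsum => h2 h3; rewrite (lin_tsum _ _ lL).
  apply: eq_tsum => m0 m1; rewrite /L tsum_pure; last by lins.
  by rewrite -(actM Hm) !antipode_evenM -antipode_powD addrC subrK !mulrA.
rewrite -(sw_comulA (F := fun h1 h2 h3 => \sw_(m0 ⊗ m1 <- ydm_coact M m)
    ydm_act (S^[2 * i] h3 * S^[2 * i] m1 * (S h1 * h2)) m0)); last by split; lins.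
rewrite -[RHS](sw_counitl (F := fun h => ydm_act (S^[2 * i] h) (ydm_sigma m)));
  last by lins.
apply: eq_tsum => a b.
rewrite (sw_cancel (F := fun x => \sw_(m0 ⊗ m1 <- ydm_coact M m)
    ydm_act (S^[2 * i] b * S^[2 * i] m1 * x) m0) (antipodel a)); last by lins.
congr (_ *: _); rewrite /ydm_sigma (lin_tsum (L := ydm_act _)); last by lins.
by apply: eq_tsum => m0 m1; rewrite mulr1 (actM Hm).
Qed.

(** Compatibility gives $S^{2i}(m_3)m_0\otimes S^{2i}(m_4)m_1S(m_2)$, in which $m_1S(m_2)$
    collapses. *)
Lemma ydm_sigma_coact m : ydm_coact M (ydm_sigma m) =
  \sw_(m0 ⊗ m1 <- ydm_coact M m) (ydm_sigma m0 ⊗ S^[2 * i] m1).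
Proof.
rewrite /ydm_sigma (lin_tsum (L := ydm_coact M)); last by lins.
pose G m0 a y := \sw_(b ⊗ z <- Δ y) \sw_(c ⊗ d <- Δ z)
  (ydm_act (S^[2 * i] c) m0 ⊗ (S^[2 * i] d * (a * S b)) : M ⊗ H).
transitivity (\sw_(m0 ⊗ m1 <- ydm_coact M m)
    \sw_(m00 ⊗ m01 <- ydm_coact M m0) G m00 m01 m1).
  apply: eq_tsum => m0 m1; rewrite ydm_compat ydm_expE.
  rewrite sw_comul_even; last by lins.
  rewrite /G [RHS]tsumC; apply: eq_tsum => b z.
  rewrite sw_comul_even; last by lins.
  rewrite [RHS]tsumC; apply: eq_tsum => c d.
  by apply: eq_tsum => m00 m01; rewrite mulrA -antipode_powD subrK.
rewrite sw_coactA; last by rewrite /G; split; lins.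
transitivity (\sw_(m0 ⊗ m1 <- ydm_coact M m) \sw_(c ⊗ d <- Δ m1)
  (ydm_act (S^[2 * i] c) m0 ⊗ S^[2 * i] d)); last first.
  rewrite -(sw_coactA (F := fun m0 c d =>
    ydm_act (S^[2 * i] c) m0 ⊗ S^[2 * i] d)); last by split; lins.
  apply: eq_tsum => m0 m1.
  by rewrite (lin_tsum (L := fun x => x ⊗ S^[2 * i] m1)) //; lins.
apply: eq_tsum => m0 m1; rewrite /G.
rewrite -(sw_comulA (F := fun a b z => \sw_(c ⊗ d <- Δ z)
  (ydm_act (S^[2 * i] c) m0 ⊗ (S^[2 * i] d * (a * S b))))); last by split; lins.
rewrite -[RHS](sw_counitl (F := fun z => \sw_(c ⊗ d <- Δ z)
  (ydm_act (S^[2 * i] c) m0 ⊗ S^[2 * i] d))); last by lins.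
apply: eq_tsum => y z.
rewrite (sw_cancel (F := fun x => \sw_(c ⊗ d <- Δ z)
  (ydm_act (S^[2 * i] c) m0 ⊗ (S^[2 * i] d * x))) (antipoder y)); last by lins.
by congr (_ *: _); apply: eq_tsum => c d; rewrite mulr1.
Qed.

(** The sum is $S^{2i}(S^{-1}(m_2)m_1)m_0$. Both inverse laws reduce to it, by [ydm_sigma_coact] and
    by [ydm_sigma_act]. *)
Lemma ydm_sigma_cancel m :
  \sw_(m0 ⊗ m1 <- ydm_coact M m)
    ydm_act (S^[2 * i] (S^[- 1] m1)) (ydm_sigma m0) = m.
Proof.
transitivity (\sw_(m0 ⊗ m1 <- ydm_coact M m) \sw_(m00 ⊗ m01 <- ydm_coact M m0)
  ydm_act (S^[2 * i] (S^[- 1] m1 * m01)) m00).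
  apply: eq_tsum => m0 m1.
  rewrite /ydm_sigma (lin_tsum (L := ydm_act _)); last by lins.
  by apply: eq_tsum => m00 m01; rewrite antipode_evenM (actM Hm).
rewrite (sw_coactA (F := fun m00 m01 m1 =>
  ydm_act (S^[2 * i] (S^[- 1] m1 * m01)) m00)); last by split; lins.
rewrite -[RHS](coact1 (ydm_comodule M)); apply: eq_tsum => m0 m1.
rewrite (sw_cancel (F := fun x => ydm_act (S^[2 * i] x) m0)
  (antipode_inv_mull m1)); last by lins.
by rewrite antipode_pow1 (act1 Hm).
Qed.

Lemma ydm_sigmaK : cancel ydm_sigma ydm_sigma_inv.
Proof.
move=> m; have lS := ydm_sigma_linear.
rewrite /ydm_sigma_inv ydm_sigma_coact.
rewrite (lin_tsum (L := fun x => \sw_(m0 ⊗ m1 <- x) ydm_act (S^[- 1] m1) m0));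
  last by lins.
rewrite -[RHS]ydm_sigma_cancel; apply: eq_tsum => m0 m1.
by rewrite tsum_pure -?antipode_powD 1?addrC //; lins.
Qed.

Lemma ydm_sigma_invK : cancel ydm_sigma_inv ydm_sigma.
Proof.
move=> m; rewrite /ydm_sigma_inv (lin_tsum (L := ydm_sigma)).
  by rewrite -[RHS]ydm_sigma_cancel; apply: eq_tsum => *; rewrite ydm_sigma_act.
exact: ydm_sigma_linear.
Qed.

(* These are the maps M -> twist (- d) M of the category, before the target is
   given its twisted structure; in this form they can be composed and iterated
   on M itself. *)
Record ydm_shift (d : int) (f : M -> M) : Prop := YDMShift {
  ydm_shift_linear : linear f;
  ydm_shift_act : forall h m, f (ydm_act h m) = ydm_act (S^[2 * d] h) (f m);
  ydm_shift_coact : forall m, ydm_coact M (f m) =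
    \sw_(m0 ⊗ m1 <- ydm_coact M m) (f m0 ⊗ S^[2 * d] m1)
}.

Lemma ydm_shift_id : ydm_shift 0 id.
Proof.
split=> [//|h m|m]; first by rewrite mulr0.
by rewrite [LHS]tens_pureE; apply: eq_tsum => *; rewrite mulr0.
Qed.

Lemma ydm_shift_comp d e f g :
  ydm_shift d f -> ydm_shift e g -> ydm_shift (d + e) (f \o g).
Proof.
move=> [lf fa fc] [lg ga gc]; split=> [c x y|h m|m] /=.
- by rewrite lg lf.
- by rewrite ga fa -antipode_powD mulrDr.
rewrite fc gc.
rewrite (lin_tsum (L := fun x => \sw_(m0 ⊗ m1 <- x) (f m0 ⊗ S^[2 * d] m1)));
  last by lins.
apply: eq_tsum => m0 m1; rewrite tsum_pure; last by lins.
by rewrite -antipode_powD mulrDr.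
Qed.

(** Transfers the properties of σ to its inverse without a second Sweedler computation. *)
Lemma ydm_shift_inv d f g :
  cancel f g -> cancel g f -> ydm_shift d f -> ydm_shift (- d) g.
Proof.
move=> fK gK [lf fa fc]; have lg : linear g.
  by move=> c x y; apply: (can_inj fK); rewrite lf !gK.
split=> // [h m|m].
  by apply: (can_inj fK); rewrite fa !gK mulrN antipode_powVK.
rewrite -[in RHS](gK m) fc.
rewrite (lin_tsum (L := fun x => \sw_(m0 ⊗ m1 <- x) (g m0 ⊗ S^[2 * - d] m1)));
  last by lins.
rewrite [LHS]tens_pureE; apply: eq_tsum => m0 m1; rewrite tsum_pure; last by lins.
by rewrite fK mulrN antipode_powK.
Qed.

Definition ydm_sigma_pow (c : int) : M -> M := ziter ydm_sigma ydm_sigma_inv c.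

Lemma ydm_sigma_powD c d m :
  ydm_sigma_pow (c + d) m = ydm_sigma_pow c (ydm_sigma_pow d m).
Proof. exact: ziterD ydm_sigmaK ydm_sigma_invK _ _ _. Qed.

Lemma ydm_sigma_pow_shift c : ydm_shift (c * i) (ydm_sigma_pow c).
Proof.
have s1 : ydm_shift i ydm_sigma.
  by split; [exact: ydm_sigma_linear|exact: ydm_sigma_act|exact: ydm_sigma_coact].
have sN : ydm_shift (- i) ydm_sigma_inv.
  exact: ydm_shift_inv ydm_sigmaK ydm_sigma_invK s1.
apply: (ziter_rec (P := fun c => ydm_shift (c * i))) => [|e u su|e u su].
- by rewrite mul0r; exact: ydm_shift_id.
- by rewrite mulrDl mul1r; exact: ydm_shift_comp.
- by rewrite mulrDl mulN1r; exact: ydm_shift_comp.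
Qed.

Lemma ydm_shift_twist_act d f g h : ydm_shift d f -> g = d + h ->
  forall x m, f (ydm_twist_act g x m) = ydm_twist_act h x (f m).
Proof.
move=> sf -> x m; rewrite /ydm_twist_act (ydm_shift_act sf) -antipode_powD.
by rewrite mulrDr opprD addNKr.
Qed.

Lemma ydm_shift_twist_coact d f g h : ydm_shift d f -> g = d + h ->
  forall m, ydm_twist_coact h M (f m) =
    \sw_(m0 ⊗ m1 <- ydm_twist_coact g M m) (f m0 ⊗ m1).
Proof.
move=> sf -> m; have lf := ydm_shift_linear sf.
rewrite sw_ydm_twist /= ?(ydm_shift_coact sf); last by lins.
rewrite (lin_tsum (L := fun x => \sw_(m0 ⊗ m1 <- x) (m0 ⊗ S^[2 * h] m1)));
  last by lins.
apply: eq_tsum => m0 m1; rewrite tsum_pure; last by lins.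
by rewrite -antipode_powD mulrDr addrC.
Qed.

Definition ydm_shift_hom d f g h (sf : ydm_shift d f) (e : g = d + h) :
    ydmHom (ydm_twist g M) (ydm_twist h M) :=
  @YDMHom _ _ _ (ydm_twist g M) (ydm_twist h M)
    (mklin f (ydm_shift_linear sf) : {linear M -> M})
    (ydm_shift_twist_act sf e) (ydm_shift_twist_coact sf e).
End Object.

(** The twists $S^{-2n}$ of the action and $S^{2n}$ of the coaction cancel, as powers of $S$
    commute; hence σ and its inverse are unchanged by twisting. *)
Lemma sw_ydm_twist_pow n (M : ydModule H j) (a : int) (m : M) :
  \sw_(m0 ⊗ m1 <- ydm_twist_coact n M m) ydm_twist_act n (S^[a] m1) m0 =
  \sw_(m0 ⊗ m1 <- ydm_coact M m) ydm_act (S^[a] m1) m0.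
Proof.
have Hm := ydm_module M.
rewrite /ydm_twist_act sw_ydm_twist; last by lins.
by apply: eq_tsum => m0 m1; rewrite -!antipode_powD addrAC addNr add0r.
Qed.

Lemma ydm_sigma_pow_twist n (M : ydModule H j) c :
  ydm_sigma_pow (M := ydm_twist n M) c =1 ydm_sigma_pow (M := M) c.
Proof.
by move=> m; apply: (ziter_conj (u := @id M)) => x; apply: sw_ydm_twist_pow.
Qed.

Lemma ydm_sigma_pow_natural (M N : ydModule H j) (f : ydmHom M N) c m :
  f (ydm_sigma_pow c m) = ydm_sigma_pow c (f m).
Proof.
have HN := ydm_module N.
apply: ziter_conj => x; rewrite /ydm_sigma /ydm_sigma_inv ydm_fun_coact.
  rewrite (lin_tsum (L := f)) ?[RHS](lin_tsum (L := fun y =>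
    \sw_(m0 ⊗ m1 <- y) ydm_act (S^[2 * i] m1) m0)); try by lins.
  by apply: eq_tsum => m0 m1; rewrite tsum_pure ?ydm_fun_act //; lins.
rewrite (lin_tsum (L := f)) ?[RHS](lin_tsum (L := fun y =>
  \sw_(m0 ⊗ m1 <- y) ydm_act (S^[- 1] m1) m0)); try by lins.
by apply: eq_tsum => m0 m1; rewrite tsum_pure ?ydm_fun_act //; lins.
Qed.

(** With [c], [g], [h] free this covers σ itself (1, 0, [- i]), its inverse powers, and all
    identifications of the descent datum. *)
Definition ydm_sigma_iso c g h (e : g = c * i + h) :
  natIso (ydm_twist_functor H j g) (ydm_twist_functor H j h).
Proof.
refine (@NatIso _ _ (ydm_twist_functor H j g) (ydm_twist_functor H j h)
  (fun M => ydm_shift_hom (ydm_sigma_pow_shift M c) e)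
  (fun M => ydm_shift_hom (ydm_sigma_pow_shift M (- c)) (sub_shift e)) _ _ _).
- by move=> M N f; apply: ydmHom_ext => m; rewrite /= ydm_sigma_pow_natural.
- by move=> M; apply: ydmHom_ext => m; rewrite /= -ydm_sigma_powD addNr.
- by move=> M; apply: ydmHom_ext => m; rewrite /= -ydm_sigma_powD subrr.
Defined.

(* For i = 0 the exponent is 0, as division by 0 gives 0, so the identifications
   are then identities. *)
Definition ydm_descent : descentDatum (to_Zmod i) (YDmod_action H j).
Proof.
refine (@DescentDatum _ _ _ (to_Zmod i) (YDmod_action H j)
  (fun g h e => ydm_sigma_iso (Zmod_quot e)) _ _ _ _).
- by move=> g h e M N f; rewrite iso_natural.
- by move=> g e M; apply: ydmHom_ext => m; rewrite /= subrr div0z.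
- move=> f g h d e de M; apply: ydmHom_ext => m /=; rewrite -ydm_sigma_powD.
  (* The quotients add because [i] divides [g - h]. *)
  rewrite -divzDl; last by rewrite -to_ZmodP e.
  by rewrite addrC addrA subrK.
- move=> g g' h h' d e de M; apply: ydmHom_ext => m /=.
  (* The factor taken on the twist by [h'] is the same power of σ on [M], so the exponents add. *)
  rewrite ydm_sigma_pow_twist -ydm_sigma_powD -divzDl; last first.
    by rewrite -to_ZmodP d.
  by rewrite addrACA opprD.
Defined.

Definition ydm_sigma_natIso c h (e : 0 = c * i + h) :
    natIso (functor_id (YDmod H j)) (YDmod_action H j h) :=
  natIso_comp (ydm_sigma_iso e) (ydm_unit_iso H j).

Lemma ydm_sigma_factors (e : 0 = 1 * i + - i) :
  factors_through_Zmod (A := YDmod_action H j) (ydm_sigma_natIso e).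
Proof.
apply: (descent_factors (φ := ydm_descent)) => i0 e' M.
(* For [i != 0] the exponent is [i %/ i = 1], so the identification is σ; for [i = 0] it would be
   0. *)
by apply: ydmHom_ext => m /=; rewrite sub0r opprK divzz i0.
Qed.
End ModuleSigma.

(** * Yetter-Drinfeld contramodules *)

(** Compares linear maps packed with different linearity proofs. *)
Lemma eq_contra (k : fieldType) (H : hopfAlgebra k) (N : lmodType k)
    (α : {linear H -> N} -> N) (f g : {linear H -> N}) : f =1 g -> α f = α g.
Proof. by move=> fg; congr α; apply: linear_ext. Qed.

Arguments eq_contra {k H N α f g} _.

Section Contramodules.
Variables (k : fieldType) (H : hopfAlgebra k) (N : lmodType k).
Variables (α : {linear H -> N} -> N) (Hα : is_contramodule α).

(** Associativity for a bilinear [F]; the three linear maps are specified pointwise so that they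
    match however their linearity was proved. *)
Lemma sw_contraA (F : H -> H -> N) (inner : H -> {linear H -> N})
    (outer total : {linear H -> N}) : bilin F ->
  (forall x, inner x =1 F x) -> (forall x, outer x = α (inner x)) ->
  (forall h, total h = \sw_(a ⊗ b <- comul H h) F a b) -> α outer = α total.
Proof.
move=> bF innerE outerE totalE.
have := contraA Hα (mklin _ (tsum_linear bF)) => E.
transitivity (α (mklin _ (tsum_linear bF) \o comul H : {linear H -> N}));
  last by apply: eq_contra => h; rewrite totalE.
rewrite -E; apply: eq_contra => x /=; rewrite outerE; apply: eq_contra => y /=.
by rewrite innerE tsum_pure.
Qed.

Lemma lin_contra (V : lmodType k) (F : V -> {linear H -> N}) :
  (forall h, linear (fun v => F v h)) -> linear (fun v => α (F v)).
Proof.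
move=> lF a x y; rewrite -(contra_lin Hα); apply: eq_contra => h.
exact: lF.
Qed.

Lemma contra1P (f : {linear H -> N}) n :
  (forall h, f h = counit H h *: n) -> α f = n.
Proof. by move=> fE; rewrite -[RHS](contra1 Hα); apply: eq_contra. Qed.
End Contramodules.

Section ContraSigma.
Variables (k : fieldType) (H : hopfAlgebra k) (i j : int) (ij : j = i + 1).
Notation Δ := (comul H).
Notation ε := (counit H).
Notation S := (antipode H).

Section Object.
Variable N : ydContra H j.
Let Hm := ydc_module N.
Let Hc := ydc_contramodule N.

Definition ydc_sigma (n : N) : N :=
  ydc_contra (mklin (fun h : H => ydc_act h n) (act_linear Hm n)).
Definition ydc_sigma_inv (n : N) : N :=
  ydc_contra (mklin (fun h : H => ydc_act (S^[2 * i - 1] h) n)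
                (act_pow_linear Hm (2 * i - 1) n)).

Lemma ydc_sigma_linear : linear ydc_sigma.
Proof. by apply: (lin_contra Hc) => h /=; lins. Qed.

(** This is where the index $i+1$ enters: $S^{2i}$ undoes $S^{2-2j}$. *)
Lemma ydc_expE : 2 - 2 * j = - (2 * i).
Proof. by rewrite ij; ring. Qed.

(** The integrands already agree: $S^{2i}(h^2S(h^3))xh^1n$ collapses to $xhn$. *)
Lemma ydc_sigma_act h n :
  ydc_sigma (ydc_act h n) = ydc_act (S^[2 * i] h) (ydc_sigma n).
Proof.
rewrite /ydc_sigma ydc_compat; apply: eq_contra => x /=.
rewrite /contra_conj ydc_expE.
rewrite sw_comul_even; last by lins.
rewrite -[LHS](sw_counitr (F := fun y => ydc_act x (ydc_act y n))); last by lins.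
apply: eq_tsum => a b; rewrite sw_comul_even; last by lins.
transitivity (\sw_(c ⊗ d <- Δ b) ydc_act (S^[2 * i] (c * S d)) (ydc_act (x * a) n)).
  rewrite (sw_cancel (F := fun y => ydc_act (S^[2 * i] y) (ydc_act (x * a) n))
    (antipoder b)); last by lins.
  by rewrite antipode_pow1 (act1 Hm) (actM Hm).
apply: eq_tsum => c d; rewrite antipode_powK -!(actM Hm) antipode_evenM.
by rewrite !antipode_powSr antipode_powS !mulrA.
Qed.

(** Associativity of α brings both sides to the contraaction of $h\mapsto h^2f(S^{-2i}(h^1))$. *)
Lemma ydc_sigma_contra (f : {linear H -> N}) :
  ydc_sigma (ydc_contra f) =
  ydc_contra (mklin ydc_sigma ydc_sigma_linear \o f \o S^[- (2 * i)]
    : {linear H -> N}).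
Proof.
have lT : linear (fun h : H => \sw_(a ⊗ b <- Δ h) ydc_act b (f (S^[- (2 * i)] a))).
  by lins.
transitivity (ydc_contra (mklin _ lT)).
  apply: (sw_contraA Hc (F := fun h => contra_conj j (@ydc_act k H j N) h f)
    (inner := fun h => mklin _ (contra_conj_linear j h f Hm))) => [||x|h] //=.
  - by rewrite /contra_conj; lins.
  - exact: ydc_compat.
  rewrite /contra_conj ydc_expE.
  (* Coassociativity, used twice, brings together $S(h^3)h^4$, which collapses. *)
  rewrite [RHS](sw_comulA (F := fun h1 z b => \sw_(h2 ⊗ h3 <- Δ z)
    ydc_act h2 (f (S h3 * b * S^[- (2 * i)] h1)))); last by split; lins.
  apply: eq_tsum => h1 y.
  rewrite [RHS](sw_comulA (F := fun h2 h3 b =>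
    ydc_act h2 (f (S h3 * b * S^[- (2 * i)] h1)))); last by split; lins.
  rewrite -[LHS](sw_counitr (F := fun y => ydc_act y (f (S^[- (2 * i)] h1))));
    last by lins.
  apply: eq_tsum => h2 z.
  rewrite (sw_cancel (F := fun x => ydc_act h2 (f (x * S^[- (2 * i)] h1)))
    (antipodel z)); last by lins.
  by rewrite mul1r.
symmetry; apply: (sw_contraA Hc
  (F := fun a b => ydc_act b (f (S^[- (2 * i)] a)))
  (inner := fun a => mklin _ (act_linear Hm (f (S^[- (2 * i)] a))))) => //.
by lins.
Qed.

(** Associativity yields α of $h\mapsto h^2S^{-1}(h^1)n=\epsilon(h)n$. Both inverse laws have this
    form, since $S^{2i-1}=S^{2i}S^{-1}$. *)
Lemma ydc_sigma_cancel n (f : {linear H -> N}) :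
  (forall h, f h = ydc_sigma (ydc_act (S^[- 1] h) n)) -> ydc_contra f = n.
Proof.
have lT : linear (fun h : H => \sw_(a ⊗ b <- Δ h) ydc_act (b * S^[- 1] a) n).
  by lins.
move=> fE; transitivity (ydc_contra (mklin _ lT)).
  apply: (sw_contraA Hc (F := fun a b => ydc_act (b * S^[- 1] a) n)
    (inner := fun a => mklin _ (act_linear Hm (ydc_act (S^[- 1] a) n)))) => //.
    by lins.
  by move=> a b /=; rewrite -(actM Hm).
apply: (contra1P Hc) => h /=.
rewrite (sw_cancel (F := fun x => ydc_act x n) (antipode_inv_mulr h)); last by lins.
by rewrite (act1 Hm).
Qed.

Lemma ydc_sigmaK : cancel ydc_sigma ydc_sigma_inv.
Proof.
move=> n; apply: ydc_sigma_cancel => h /=.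
by rewrite antipode_powD ydc_sigma_act.
Qed.

Lemma ydc_sigma_invK : cancel ydc_sigma_inv ydc_sigma.
Proof.
move=> n; rewrite /ydc_sigma_inv ydc_sigma_contra; apply: ydc_sigma_cancel => h /=.
by rewrite -antipode_powD addrAC subrr add0r.
Qed.

(** The contramodule analogue of [ydm_shift]. Relating [x] and [y] by an equation keeps the last
    condition symmetric under inverting [f]. *)
Record ydc_shift (d : int) (f : N -> N) : Prop := YDCShift {
  ydc_shift_linear : linear f;
  ydc_shift_act : forall h n, f (ydc_act h n) = ydc_act (S^[2 * d] h) (f n);
  ydc_shift_contra : forall x y : {linear H -> N},
    (forall h, f (x h) = y (S^[2 * d] h)) -> f (ydc_contra x) = ydc_contra y
}.

Lemma ydc_shift_id : ydc_shift 0 id.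
Proof.
split=> [//|h m|x y xy]; first by rewrite mulr0.
by apply: eq_contra => h; rewrite xy mulr0.
Qed.

Lemma ydc_shift_comp d e f g :
  ydc_shift d f -> ydc_shift e g -> ydc_shift (d + e) (f \o g).
Proof.
move=> [lf fa fc] [lg ga gc]; split=> [c x y|h m|x y xy] /=.
- by rewrite lg lf.
- by rewrite ga fa -antipode_powD mulrDr.
(* The intermediate map is forced: its composite with $S^{2e}$ must be $g\circ x$. *)
rewrite (gc x (mklin g lg \o x \o S^[- (2 * e)] : {linear H -> N})).
  by apply: fc => h /=; rewrite [LHS]xy -antipode_powD mulrDr addrK.
by move=> h /=; rewrite antipode_powK.
Qed.

Lemma ydc_shift_inv d f g :
  cancel f g -> cancel g f -> ydc_shift d f -> ydc_shift (- d) g.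
Proof.
move=> fK gK [lf fa fc]; have lg : linear g.
  by move=> c x y; apply: (can_inj fK); rewrite lf !gK.
split=> // [h m|x y xy]; apply: (can_inj fK).
  by rewrite fa !gK mulrN antipode_powVK.
rewrite gK; symmetry; apply: fc => h.
by apply: (can_inj gK); rewrite fK xy mulrN antipode_powK.
Qed.

Definition ydc_sigma_pow (c : int) : N -> N := ziter ydc_sigma ydc_sigma_inv c.

Lemma ydc_sigma_powD c d m :
  ydc_sigma_pow (c + d) m = ydc_sigma_pow c (ydc_sigma_pow d m).
Proof. exact: ziterD ydc_sigmaK ydc_sigma_invK _ _ _. Qed.

Lemma ydc_sigma_pow_shift c : ydc_shift (c * i) (ydc_sigma_pow c).
Proof.
have s1 : ydc_shift i ydc_sigma.
  split; [exact: ydc_sigma_linear|exact: ydc_sigma_act|move=> x y xy].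
  rewrite ydc_sigma_contra; apply: eq_contra => h /=.
  by rewrite xy antipode_powVK.
have sN : ydc_shift (- i) ydc_sigma_inv.
  exact: ydc_shift_inv ydc_sigmaK ydc_sigma_invK s1.
apply: (ziter_rec (P := fun c => ydc_shift (c * i))) => [|e u su|e u su].
- by rewrite mul0r; exact: ydc_shift_id.
- by rewrite mulrDl mul1r; exact: ydc_shift_comp.
- by rewrite mulrDl mulN1r; exact: ydc_shift_comp.
Qed.

Lemma ydc_shift_twist_act d f g h : ydc_shift d f -> g = d + h ->
  forall x m, f (ydc_twist_act g x m) = ydc_twist_act h x (f m).
Proof.
move=> sf -> x m; rewrite /ydc_twist_act (ydc_shift_act sf) -antipode_powD.
by rewrite mulrDr opprD addNKr.
Qed.

Lemma ydc_shift_twist_contra d f g h (sf : ydc_shift d f) : g = d + h ->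
  forall x : {linear H -> N}, f (ydc_twist_contra g x) =
    ydc_twist_contra h (mklin f (ydc_shift_linear sf) \o x : {linear H -> N}).
Proof.
move=> -> x; apply: (ydc_shift_contra sf) => y /=.
by rewrite -antipode_powD mulrDr addrC.
Qed.

Definition ydc_shift_hom d f g h (sf : ydc_shift d f) (e : g = d + h) :
    ydcHom (ydc_twist g N) (ydc_twist h N) :=
  @YDCHom _ _ _ (ydc_twist g N) (ydc_twist h N)
    (mklin f (ydc_shift_linear sf) : {linear N -> N})
    (ydc_shift_twist_act sf e) (ydc_shift_twist_contra sf e).
End Object.

Lemma ydc_sigma_pow_twist n (N : ydContra H j) c :
  ydc_sigma_pow (N := ydc_twist n N) c =1 ydc_sigma_pow (N := N) c.
Proof.
move=> m; apply: (ziter_conj (u := @id N)) => x.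
  apply: (@eq_contra _ _ _ (@ydc_contra k H j N)) => h /=.
  by rewrite /ydc_twist_act antipode_powK.
apply: (@eq_contra _ _ _ (@ydc_contra k H j N)) => h /=.
by rewrite /ydc_twist_act -!antipode_powD addrAC addNr add0r.
Qed.

Lemma ydc_sigma_pow_natural (M N : ydContra H j) (f : ydcHom M N) c m :
  f (ydc_sigma_pow c m) = ydc_sigma_pow c (f m).
Proof.
by apply: ziter_conj => x; rewrite [LHS]ydc_fun_contra; apply: eq_contra => h /=;
  rewrite ydc_fun_act.
Qed.

Definition ydc_sigma_iso c g h (e : g = c * i + h) :
  natIso (ydc_twist_functor H j g) (ydc_twist_functor H j h).
Proof.
refine (@NatIso _ _ (ydc_twist_functor H j g) (ydc_twist_functor H j h)
  (fun M => ydc_shift_hom (ydc_sigma_pow_shift M c) e)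
  (fun M => ydc_shift_hom (ydc_sigma_pow_shift M (- c)) (sub_shift e)) _ _ _).
- by move=> M N f; apply: ydcHom_ext => m; rewrite /= ydc_sigma_pow_natural.
- by move=> M; apply: ydcHom_ext => m; rewrite /= -ydc_sigma_powD addNr.
- by move=> M; apply: ydcHom_ext => m; rewrite /= -ydc_sigma_powD subrr.
Defined.

Definition ydc_descent : descentDatum (to_Zmod i) (YDctrmd_action H j).
Proof.
refine (@DescentDatum _ _ _ (to_Zmod i) (YDctrmd_action H j)
  (fun g h e => ydc_sigma_iso (Zmod_quot e)) _ _ _ _).
- by move=> g h e M N f; rewrite iso_natural.
- by move=> g e M; apply: ydcHom_ext => m; rewrite /= subrr div0z.
- move=> f g h d e de M; apply: ydcHom_ext => m /=; rewrite -ydc_sigma_powD.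
  rewrite -divzDl; last by rewrite -to_ZmodP e.
  by rewrite addrC addrA subrK.
- move=> g g' h h' d e de M; apply: ydcHom_ext => m /=.
  rewrite ydc_sigma_pow_twist -ydc_sigma_powD -divzDl; last first.
    by rewrite -to_ZmodP d.
  by rewrite addrACA opprD.
Defined.

Definition ydc_sigma_natIso c h (e : 0 = c * i + h) :
    natIso (functor_id (YDctrmd H j)) (YDctrmd_action H j h) :=
  natIso_comp (ydc_sigma_iso e) (ydc_unit_iso H j).

Lemma ydc_sigma_factors (e : 0 = 1 * i + - i) :
  factors_through_Zmod (A := YDctrmd_action H j) (ydc_sigma_natIso e).
Proof.
apply: (descent_factors (φ := ydc_descent)) => i0 e' M.
by apply: ydcHom_ext => m /=; rewrite sub0r opprK divzz i0.
Qed.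
End ContraSigma.

Theorem mainTheorem19 (k : fieldType) (k_char0 : [pchar k] =i pred0)
    (H : hopfAlgebra k) (i : int) :
  [/\ exists s : natIso (functor_id (YDmod H (i - 1)))
                        (YDmod_action H (i - 1) (- i)),
      [/\ forall (M : ydModule H (i - 1)) (m : M),
            (s M : ydmHom M (ydm_twist (- i) M)) m =
            \sw_(m0 ⊗ m1 <- ydm_coact M m) ydm_act (S^[2 * i] m1) m0,
          forall (M : ydModule H (i - 1)) (m : M),
            (iso_inv s M : ydmHom (ydm_twist (- i) M) M) m =
            \sw_(m0 ⊗ m1 <- ydm_coact M m) ydm_act (S^[- 1] m1) m0 &
          factors_through_Zmod s],
      exists s : natIso (functor_id (YDctrmd H (i + 1)))
                        (YDctrmd_action H (i + 1) (- i)),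
      [/\ forall (N : ydContra H (i + 1)) (n : N),
            (s N : ydcHom N (ydc_twist (- i) N)) n =
            ydc_contra (mklin (fun h : H => ydc_act h n)
                          (act_linear (ydc_module N) n)),
          forall (N : ydContra H (i + 1)) (n : N),
            (iso_inv s N : ydcHom (ydc_twist (- i) N) N) n =
            ydc_contra (mklin (fun h : H => ydc_act (S^[2 * i - 1] h) n)
                          (act_pow_linear (ydc_module N) (2 * i - 1) n)) &
          factors_through_Zmod s] &
      exists t : natIso (functor_id (YDmod H 0)) (YDmod_action H 0 1),
        (forall (M : ydModule H 0) (m : M),
           (t M : ydmHom M (ydm_twist 1 M)) m =
           \sw_(m0 ⊗ m1 <- ydm_coact M m) ydm_act (S^[- 1] m1) m0) /\
        (forall (M : ydModule H 0) (m : M),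
           (iso_inv t M : ydmHom (ydm_twist 1 M) M) m =
           \sw_(m0 ⊗ m1 <- ydm_coact M m) ydm_act (S^[2] m1) m0)].
Proof.
have e : 0 = 1 * i + - i by rewrite mul1r subrr.
split.
(* The powers 1 and -1 compute to [ydm_sigma] and [ydm_sigma_inv], so both formulas hold by
   conversion. *)
- exists (ydm_sigma_natIso H (erefl (i - 1)) e); split=> //.
  exact: ydm_sigma_factors.
- exists (ydc_sigma_natIso H (erefl (i + 1)) e); split=> //.
  exact: ydc_sigma_factors.
(* For [i = 1], σ lands in the twist by -1; its power -1 lands in the twist by 1, so [t] uses
   $S^{-1}$ and its inverse $S^2$. *)
- have e1 : 0 = -1 * 1 + 1 :> int by [].
  by exists (ydm_sigma_natIso H (i := 1) (j := 0) (erefl _) e1); split.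
Qed.
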